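(* Let $M_1,\ldots,M_s$ be $m\times m$ positive semidefinite matrices such that $\sum_{k=1}^sM_k$ has full rank $m$, let $c_1,\ldots,c_s\ge0$ be costs and $B>0$ a budget, let $p\in[0,1]$, and let $\boldsymbol{w}^*$ be an optimal solution of the continuous problem $$\max_{\boldsymbol{w}\in\mathbb{R}^s}\Big\{\Phi_p\big(M_F(\boldsymbol{w})\big):\ \boldsymbol{w}\ge\boldsymbol{0},\ \sum_{i\in[s]}c_iw_i\le B\Big\}.$$ Then, for any $\boldsymbol{n}\in\mathbb{N}^s$, $$\frac1B\sum_{i\in[s]}c_i\,n_i^p\,(w_i^* )^{1-p}\ \le\ \frac{\varphi_p(\boldsymbol{n})}{\varphi_p(\boldsymbol{w}^* )}.$$
   Context: $[s]:=\{1,\ldots,s\}$, $\mathbb{N}$ contains $0$; positive semidefinite matrices are real symmetric. For $\boldsymbol{w}\in\mathbb{R}_+^s$, $M_F(\boldsymbol{w}):=\sum_{i=1}^sw_iM_i$. For an $m\times m$ positive semidefinite matrix $M$ with eigenvalues $\lambda_1,\dots,\lambda_m$ (with multiplicities), $\operatorname{trace}M^p:=\sum_k\lambda_k^p$ if $p\in(0,1]$ and $\operatorname{trace}M^0:=\operatorname{rank}M$. The criterion is $\Phi_p(M)=\big(\frac1m\operatorname{trace}M^p\big)^{1/p}$ for $p\in(0,1]$, and $\Phi_0(M)=(\det M)^{1/m}$. Moreover $\varphi_p(\boldsymbol{w}):=\operatorname{trace}M_F(\boldsymbol{w})^p$ for $\boldsymbol{w}\in\mathbb{R}_+^s$ (in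 particular for $\boldsymbol{w}=\boldsymbol{n}\in\mathbb{N}^s$); it is a rank when $p=0$. For the scalar powers $n_i^p$ and $(w_i^* )^{1-p}$ the convention $0^0=0$ is adopted. *)

(* Defs.v *)
From mathcomp Require Import all_boot all_order all_algebra.
From mathcomp Require Import complex.
From mathcomp Require Import all_classical all_reals all_analysis.

Set Implicit Arguments.
Unset Strict Implicit.
Unset Printing Implicit Defensive.
Import Order.TTheory GRing.Theory Num.Theory.
Local Open Scope ring_scope.

Definition psdmx (R : realType) (m : nat) (M : 'M[R]_m) : Prop :=
  M \is symmetricmx /\ forall v : 'cV[R]_m, 0 <= (v^T *m M *m v) ord0 ord0.

(* The real eigenvalues of M listed with their algebraic multiplicities; the
   order is unspecified.  The list is junk when the characteristic polynomial
   of M does not split over R, which never happens for a symmetric M, see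
   eigenvaluesP. *)
Definition eigenvalues (R : realType) (m : nat) (M : 'M[R]_m) : seq R :=
  xget [::] [set l : seq R | char_poly M = \prod_(x <- l) ('X - x%:P)]%classic.

Lemma eigenvaluesP (R : realType) (m : nat) (M : 'M[R]_m) :
  M \is symmetricmx ->
  char_poly M = \prod_(x <- eigenvalues M) ('X - x%:P).
Proof.
move=> symM; pose toC := real_complex R.
suff [l Ml] : exists l : seq R, char_poly M = \prod_(x <- l) ('X - x%:P).
  by rewrite /eigenvalues; case: xgetP => [l' _ //|/(_ l)]; case.
have MT : M = M^T.
  by move/is_hermitianmxP: symM; rewrite expr0 scale1r map_mx_id.
pose A : 'M[R[i]]_m := map_mx toC M.
have hermA : A \is hermsymmx.
  apply/is_hermitianmxP; rewrite expr0 scale1r; apply/matrixP => i j.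
  rewrite !mxE {1}MT mxE; apply/esym/CrealP.
  by apply/complex_realP; exists (M j i).
have /hermitian_normalmx /orthomx_spectralP := hermA.
have /mxOverP realD := hermitian_spectral_diag_real hermA.
have := spectral_unit A.
set P := spectralmx A; set D := spectral_diag A => uP AE.
have cA : char_poly A = \prod_(i < m) ('X - (D ord0 i)%:P).
  have -> : char_poly A = char_poly (diag_mx D).
    rewrite /char_poly.
    have -> : char_poly_mx A = map_mx (@polyC _) (invmx P)
                *m char_poly_mx (diag_mx D) *m map_mx (@polyC _) P.
      rewrite /char_poly_mx AE !map_mxM mulmxBr mulmxBl; congr (_ - _).
      by rewrite scalar_mxC -mulmxA -map_mxM mulVmx // map_mx1 mulmx1.
    rewrite !det_mulmx mulrC mulrA -det_mulmx -map_mxM mulmxV //.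
    by rewrite map_mx1 det1 mul1r.
  rewrite char_poly_trig ?diag_mx_is_trig //.
  by apply: eq_bigr => i _; rewrite mxE eqxx mulr1n.
exists [seq complex.Re (D ord0 i) | i <- enum 'I_m].
apply: (@map_poly_inj _ _ toC); rewrite map_char_poly -/A cA.
rewrite rmorph_prod big_map big_enum /=; apply: eq_bigr => i _.
by rewrite rmorphB /= map_polyX map_polyC /= RRe_real // realD.
Qed.

(* trace M^p for M positive semidefinite and 0 <= p <= 1, with trace M^0 the
   rank of M: at p = 0 the sum would give m, since 0 `^ 0 = 1. *)
Definition tracepow (R : realType) (m : nat) (p : R) (M : 'M[R]_m) : R :=
  if p == 0 then (\rank M)%:R else \sum_(x <- eigenvalues M) x `^ p.

Definition Phi (R : realType) (m : nat) (p : R) (M : 'M[R]_m) : R :=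
  if p == 0 then (\det M) `^ (m%:R^-1)
  else (m%:R^-1 * tracepow p M) `^ (p^-1).

Definition info_mx (R : realType) (m s : nat) (M : 'I_s -> 'M[R]_m)
    (w : 'I_s -> R) : 'M[R]_m :=
  \sum_(i < s) w i *: M i.

Definition phi (R : realType) (m s : nat) (M : 'I_s -> 'M[R]_m) (p : R)
    (w : 'I_s -> R) : R :=
  tracepow p (info_mx M w).

Definition feasible (R : realType) (s : nat) (c : 'I_s -> R) (B : R)
    (w : 'I_s -> R) : Prop :=
  (forall i, 0 <= w i) /\ \sum_(i < s) c i * w i <= B.

Definition optimal_design (R : realType) (m s : nat) (M : 'I_s -> 'M[R]_m)
    (c : 'I_s -> R) (B p : R) (w : 'I_s -> R) : Prop :=
  feasible c B w /\
  forall v : 'I_s -> R, feasible c B v ->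
    Phi p (info_mx M v) <= Phi p (info_mx M w).

(* Scalar power with the convention 0^0 = 0, whereas 0 `^ 0 = 1. *)
Definition spow (R : realType) (a x : R) : R := if a == 0 then 0 else a `^ x.

(* Main.v *)
(* With W = sum_i w_i M_i, let P_i = w_i M_i, t_i = n_i / w_i, and let
   <W^(p-1), P> denote the trace of W^(p-1) P.  For 0 < p < 1 everything rests
   on the inequality
     sum_i t_i^p <W^(p-1), P_i>  <=  trace (sum_i t_i P_i)^p     (T)
   valid for psd P_i with sum P_i <= W.  Up to a constant, (T) is elementary:
   restrict to indices with t_i ~ t and to eigenvectors of W with eigenvalue
   ~ l; there the compressed form is at most t l, and counting dimensions bounds
   its trace by sum_j min (t l, mu_j) with mu_j the eigenvalues of the right-hand
   side.  Since logarithmic classes of t_i and of the eigenvalues suffice, the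
   constant grows only polynomially when all data are replaced by their N-fold
   tensor powers, whereas both sides of (T) are raised to the power N; hence the
   constant is 1.

   (T) is used twice.  Applied to the optimal design with one t_i lowered to
   1 - d, it bounds the loss of the criterion from below, and comparison with the
   rescaled design gives the optimality condition
   c_i trace W^p <= B <W^(p-1), M_i> whenever w_i > 0.  Applied to
   t_i = n_i / w_i, it yields the theorem.  For p = 1 the criterion is linear;
   for p = 0 the determinant replaces the trace in the optimality condition, and
   (T) becomes trace E <= rank E for a form E bounded by the identity. *)

Require Import Defs.
From mathcomp Require Import all_boot all_order all_algebra.
From mathcomp Require Import all_classical all_reals all_analysis.
From mathcomp Require Import ring lra.

Set Implicit Arguments.
Unset Strict Implicit.
Unset Printing Implicit Defensive.
Import Order.TTheory GRing.Theory Num.Theory.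
Local Open Scope ring_scope.

(** * Orthogonal projectors *)

Lemma cV_sqr_sum (R : realType) (n : nat) (z : 'cV[R]_n) :
  (z^T *m z) ord0 ord0 = \sum_i z i ord0 ^+ 2.
Proof. by rewrite mxE; apply: eq_bigr => i _; rewrite mxE expr2. Qed.

(** Gram-Schmidt, one vector at a time: a nonzero residual [z = v - F v] contributes the rank-one
    projector [z z^T / |z|^2], of trace 1, and a zero residual changes nothing. The trace bound is
    what later serves as a dimension count. *)
Lemma orthogonal_projector (R : realType) (n : nat) (s : seq 'cV[R]_n) :
  exists F : 'M[R]_n, [/\ F^T = F, F *m F = F,
    {in s, forall v, F *m v = v} & \tr F <= (size s)%:R].
Proof.
elim: s => [|v s [F [FT FF Fs trF]]].
  by exists 0; rewrite trmx0 mulmx0 raddf0; split.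
pose z := v - F *m v; pose a := (z^T *m z) ord0 ord0.
have Fz : F *m z = 0 by rewrite mulmxBr mulmxA FF subrr.
have zF : z^T *m F = 0 by rewrite -FT -trmx_mul Fz trmx0.
have zz : z^T *m z = a%:M by rewrite [LHS]mx11_scalar.
have [a0|a0] := eqVneq a 0.
  exists F; split=> // [u|]; last first.
    by rewrite (le_trans trF)// ler_nat.
  rewrite inE => /predU1P[->|/Fs//].
  suff : z = 0 by rewrite /z => /eqP; rewrite subr_eq0 => /eqP/esym.
  move: a0; rewrite /a cV_sqr_sum => /eqP.
  rewrite psumr_eq0 => [/allP h|i _]; last exact: sqr_ge0.
  apply/matrixP => i j; rewrite ord1 [RHS]mxE; apply/eqP.
  by have := h i (mem_index_enum _); rewrite sqrf_eq0.
exists (F + a^-1 *: (z *m z^T)); split.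
- by rewrite linearD linearZ /= trmx_mul trmxK FT.
- rewrite mulmxDl !mulmxDr FF -!scalemxAl -!scalemxAr.
  rewrite (mulmxA F) Fz mul0mx -(mulmxA z) zF mulmx0 -(mulmxA z).
  rewrite (mulmxA z^T) zz mul_scalar_mx -scalemxAr !scaler0 addr0 add0r.
  by rewrite !scalerA mulVf// mulr1.
- move=> u; rewrite inE => /predU1P[->|us].
    rewrite mulmxDl -scalemxAl -mulmxA.
    have -> : z^T *m v = a%:M.
      by rewrite -zz {2}/z mulmxBr mulmxA zF mul0mx subr0.
    rewrite mul_mx_scalar scalerA mulVf// scale1r /z.
    by rewrite addrC subrK.
  rewrite mulmxDl Fs// -scalemxAl -mulmxA -{2}(Fs u us) (mulmxA z^T) zF.
  by rewrite mul0mx mulmx0 scaler0 addr0.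
- rewrite linearD linearZ /= mxtrace_mulC zz mxtrace_scalar mulr1n mulVf//.
  by rewrite [(size _).+1]/= -addn1 natrD lerD2r.
Qed.

(** Functions on finite types replace matrices so that tensor powers can be indexed directly by
    pairs. *)
Lemma orthogonal_projector_fun (R : realType) (K J : finType) (v : J -> K -> R)
    (G : {set J}) :
  exists F : K -> K -> R, [/\ forall k l, F k l = F l k,
    forall k h, \sum_l F k l * F l h = F k h,
    forall j, j \in G -> forall k, \sum_l F k l * v j l = v j k &
    \sum_k F k k <= #|G|%:R].
Proof.
pose mx j : 'cV[R]_#|K| := \col_i v j (enum_val i).
have [F [FT FF Fs trF]] := orthogonal_projector [seq mx j | j <- enum G].
have sumE (f : 'I_#|K| -> R) : \sum_i f i = \sum_k f (enum_rank k).
  by rewrite (reindex enum_rank)//; exact/onW_bij/enum_rank_bij.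
exists (fun k l => F (enum_rank k) (enum_rank l)); split.
- by move=> k l; rewrite -{1}FT mxE.
- by move=> k h; rewrite -{3}FF mxE sumE.
- move=> j jG k; have /Fs/matrixP : mx j \in [seq mx j | j <- enum G].
    by apply: map_f; rewrite mem_enum.
  move=> /(_ (enum_rank k) ord0); rewrite !mxE enum_rankK sumE => <-.
  by apply: eq_bigr => l _; rewrite mxE enum_rankK.
- by move: trF; rewrite size_map -cardE /mxtrace sumE.
Qed.

(** Symmetry and idempotence give [<z, F z> = |F z|^2], so the cross term in [|z - F z|^2]
    collapses. *)
Lemma projector_pythagoras (R : realType) (K : finType) (F : K -> K -> R)
    (z : K -> R) :
  (forall k l, F k l = F l k) -> (forall k h, \sum_l F k l * F l h = F k h) ->
  \sum_k z k ^+ 2 = \sum_k (\sum_l F k l * z l) ^+ 2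
    + \sum_k (z k - \sum_l F k l * z l) ^+ 2.
Proof.
move=> FT FF; set y := fun k => \sum_l F k l * z l.
have Fy k : \sum_l F k l * y l = y k.
  rewrite /y; under eq_bigr => l _ do rewrite mulr_sumr.
  rewrite exchange_big /=; apply: eq_bigr => h _.
  by rewrite -FF mulr_suml; apply: eq_bigr => l _; rewrite mulrA.
have yz : \sum_k y k ^+ 2 = \sum_k z k * y k.
  under eq_bigr => k _ do rewrite expr2 {1}/y mulr_suml.
  rewrite exchange_big /=; apply: eq_bigr => l _.
  rewrite -Fy mulr_sumr; apply: eq_bigr => k _.
  by rewrite (FT l k); ring.
rewrite -!/(y _) -[RHS]/(\sum_k y k ^+ 2 + \sum_k (z k - y k) ^+ 2).
suff : \sum_k (z k - y k) ^+ 2 = \sum_k z k ^+ 2 - \sum_k y k ^+ 2.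
  by move=> ->; rewrite addrC subrK.
have -> : \sum_k z k ^+ 2 - \sum_k y k ^+ 2
    = \sum_k z k ^+ 2 - (\sum_k z k * y k) *+ 2 + \sum_k y k ^+ 2.
  by rewrite -yz; ring.
rewrite -sumrMnl -sumrB -big_split /=.
by apply: eq_bigr => k _; ring.
Qed.

Lemma sum_sqr_orthonormal (R : realType) (K J : finType) (O : J -> K -> R)
    (b : J -> R) (P : pred J) :
  (forall j j', \sum_k O j k * O j' k = (j == j')%:R) ->
  \sum_k (\sum_(j | P j) b j * O j k) ^+ 2 = \sum_(j | P j) b j ^+ 2.
Proof.
move=> Orow.
under eq_bigr => k _ do rewrite expr2 big_distrlr /=.
rewrite exchange_big /=; apply: eq_bigr => j Pj.
rewrite exchange_big /= (bigD1 j)//= [X in _ + X]big1 ?addr0.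
  under eq_bigr => k _ do rewrite mulrACA.
  by rewrite -mulr_sumr Orow eqxx mulr1 expr2.
move=> j' /andP[_ j'j].
under eq_bigr => k _ do rewrite mulrACA.
by rewrite -mulr_sumr Orow eq_sym (negbTE j'j) mulr0.
Qed.

(* Project the masked rows onto the span of the masked [O j] with [mu j] large:
   the projected part has energy at most [tau * ell] per dimension, and the
   residual only sees the small [mu j]. *)
Lemma masked_energy_le (R : realType) (I K J : finType) (t : I -> R)
    (lam : K -> R) (alpha : I -> K -> R) (O : J -> K -> R) (mu : J -> R)
    (S : pred I) (L : pred K) (tau ell : R) :
  (forall i, 0 <= t i) -> (forall i, S i -> t i <= tau) ->
  (forall k, L k -> lam k <= ell) -> 0 <= ell -> 0 <= tau ->
  (forall j j', \sum_k O j k * O j' k = (j == j')%:R) ->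
  (forall k l, \sum_j O j k * O j l = (k == l)%:R) ->
  (forall z : K -> R,
    \sum_i (\sum_k alpha i k * z k) ^+ 2 <= \sum_k lam k * z k ^+ 2) ->
  (forall j, \sum_i t i * (\sum_k alpha i k * O j k) ^+ 2 <= mu j) ->
  \sum_(i | S i) \sum_(k | L k) t i * alpha i k ^+ 2
    <= \sum_j Num.min (tau * ell) (mu j).
Proof.
move=> t0 ttau lamell ell0 tau0 Orow Ocol H1 H2; set rho := tau * ell.
pose G := [set j | rho < mu j].
pose mask (f : K -> R) k := if L k then f k else 0.
pose b i j := \sum_k alpha i k * O j k.
have [F [FT FF FG trF]] := orthogonal_projector_fun (fun j => mask (O j)) G.
pose y i k := \sum_(j | j \notin G) b i j * O j k.
have alphaE i k : alpha i k = \sum_j b i j * O j k.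
  under eq_bigr => j _ do rewrite mulr_suml.
  rewrite exchange_big /= (bigD1 k)//= [X in _ + X]big1 ?addr0.
    by under eq_bigr => j _ do rewrite -mulrA;
      rewrite -mulr_sumr Ocol eqxx mulr1.
  move=> l lk; under eq_bigr => j _ do rewrite -mulrA.
  by rewrite -mulr_sumr Ocol (negbTE lk) mulr0.
have maskD f g k : mask (fun k => f k + g k) k = mask f k + mask g k.
  by rewrite /mask; case: ifP; rewrite ?addr0.
(* The components of [alpha i] along [O j] with [j] in [G] become, once masked, vectors fixed by
   [F], hence they leave no residual. *)
have resid i k : mask (alpha i) k - \sum_l F k l * mask (alpha i) l
    = mask (y i) k - \sum_l F k l * mask (y i) l.
  pose x k := \sum_(j in G) b i j * mask (O j) k.
  have aE l : mask (alpha i) l = x l + mask (y i) l.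
    rewrite /x /mask; case: ifP => _; last first.
      by rewrite big1 ?addr0// => j _; rewrite mulr0.
    by rewrite alphaE (bigID (mem G)).
  under eq_bigr => l _ do rewrite aE mulrDr.
  rewrite aE big_split /=.
  suff -> : \sum_l F k l * x l = x k by rewrite opprD addrACA subrr add0r.
  rewrite /x; under eq_bigr => l _ do rewrite mulr_sumr.
  rewrite exchange_big /=; apply: eq_bigr => j jG.
  by rewrite -(FG j jG k) mulr_sumr; apply: eq_bigr => l _; rewrite mulrCA.
have -> : \sum_(i | S i) \sum_(k | L k) t i * alpha i k ^+ 2
    = \sum_(i | S i) t i * \sum_k (\sum_l F k l * mask (alpha i) l) ^+ 2
    + \sum_(i | S i)
        t i * \sum_k (mask (y i) k - \sum_l F k l * mask (y i) l) ^+ 2.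
  rewrite -big_split /=; apply: eq_bigr => i Si.
  rewrite -mulrDr -mulr_sumr; congr (_ * _).
  under [X in _ = _ + X]eq_bigr => k _ do rewrite -resid.
  rewrite -projector_pythagoras// big_mkcond /=.
  by apply: eq_bigr => k _; rewrite /mask; case: ifP; rewrite ?expr0n.
rewrite (bigID (mem G)) /=; apply: lerD.
  have -> : \sum_(j in G) Num.min rho (mu j) = rho * #|G|%:R.
    rewrite -sum1_card natr_sum mulr_sumr; apply: eq_bigr => j.
    by rewrite inE mulr1 => /ltW/min_idPl.
  apply: (@le_trans _ _ (rho * \sum_k F k k)); last first.
    by rewrite ler_wpM2l// mulr_ge0.
  under eq_bigr => i _ do rewrite mulr_sumr.
  rewrite exchange_big /= mulr_sumr; apply: ler_sum => k _.
  (* The upper constraint is tested on the masked row [k] of [F]. Its energy is at most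
     [ell * F k k], and summing over [k] produces the trace of [F]. *)
  apply: (@le_trans _ _
    (tau * \sum_i (\sum_l alpha i l * mask (F k) l) ^+ 2)).
    rewrite mulr_sumr [leLHS]big_mkcond /=; apply: ler_sum => i _.
    have -> : \sum_l F k l * mask (alpha i) l
        = \sum_l alpha i l * mask (F k) l.
      apply: eq_bigr => l _; rewrite /mask.
      by case: ifP => _; rewrite ?mulr0// mulrC.
    case: ifP => Si; last by rewrite mulr_ge0// sqr_ge0.
    by rewrite ler_wpM2r ?sqr_ge0// ttau.
  rewrite /rho -mulrA ler_wpM2l// (le_trans (H1 _))// -FF mulr_sumr.
  apply: ler_sum => l _; rewrite /mask; case: ifP => Ll.
    by rewrite (FT l k) -expr2 ler_wpM2r ?sqr_ge0// lamell.
  by rewrite expr0n mulr0 (FT l k) -expr2 mulr_ge0// sqr_ge0.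
have -> : \sum_(j | j \notin G) Num.min rho (mu j) = \sum_(j | j \notin G) mu j.
  by apply: eq_bigr => j; rewrite inE -leNgt => /min_idPr.
(* The residual is no longer than the masked [y i], hence no longer than [y i], whose energy
   Parseval expresses through the [b i j] with [j] outside [G]. *)
apply: (@le_trans _ _ (\sum_(j | j \notin G) \sum_i t i * b i j ^+ 2)); last first.
  by apply: ler_sum => j _; exact: H2.
rewrite exchange_big /= [leLHS]big_mkcond /=; apply: ler_sum => i _.
case: ifP => _; last by apply: sumr_ge0 => j _; rewrite mulr_ge0// sqr_ge0.
rewrite -mulr_sumr ler_wpM2l//.
rewrite -(sum_sqr_orthonormal (b i) _ Orow).
apply: (@le_trans _ _ (\sum_k mask (y i) k ^+ 2)).
  rewrite [leRHS](@projector_pythagoras _ _ F)// lerDr.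
  by apply: sumr_ge0 => k _; exact: sqr_ge0.
apply: ler_sum => k _; rewrite /mask; case: ifP => _ //.
by rewrite expr0n sqr_ge0.
Qed.

(** * The tensor power trick *)

(* [expR (x i)] are the multipliers t_i and [expR (y k)] the eigenvalues of W.
   In an eigenbasis of W, [alpha i] is a vector a_i with P = a_i a_i^T, and the
   rows of [O] are the eigenvectors of a matrix N with eigenvalues [mu]: the
   last two fields relax sum_i a_i a_i^T <= W and sum_i t_i a_i a_i^T <= N. *)
Record frame_data (R : realType) (I K J : finType) (x : I -> R) (y : K -> R)
    (alpha : I -> K -> R) (O : J -> K -> R) (mu : J -> R) : Prop := FrameData {
  frame_row : forall j j', \sum_k O j k * O j' k = (j == j')%:R;
  frame_col : forall k l, \sum_j O j k * O j l = (k == l)%:R;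
  frame_upper : forall z : K -> R,
    \sum_i (\sum_k alpha i k * z k) ^+ 2 <= \sum_k expR (y k) * z k ^+ 2;
  frame_lower : forall j,
    \sum_i expR (x i) * (\sum_k alpha i k * O j k) ^+ 2 <= mu j }.

(** The left side of (T): the sum of [t_i^p a_i^T W^(p-1) a_i], written in an eigenbasis of [W] with
    logarithmic data. *)
Definition frame_lhs (R : realType) (I K : finType) (p : R) (x : I -> R)
    (y : K -> R) (alpha : I -> K -> R) : R :=
  \sum_i \sum_k expR (p * x i + (p - 1) * y k) * alpha i k ^+ 2.

Lemma frame_mu_ge0 (R : realType) (I K J : finType) (x : I -> R) (y : K -> R)
    (alpha : I -> K -> R) (O : J -> K -> R) (mu : J -> R) :
  frame_data x y alpha O mu -> forall j, 0 <= mu j.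
Proof.
move=> d j; apply: le_trans (frame_lower d j).
by apply: sumr_ge0 => i _; rewrite mulr_ge0 ?expR_ge0 ?sqr_ge0.
Qed.

(** The minimum of two numbers is at most any of their weighted geometric means. *)
Lemma min_le_powR (R : realType) (p rho m : R) : 0 <= p <= 1 -> 0 < rho ->
  0 <= m -> Num.min rho m <= rho `^ (1 - p) * m `^ p.
Proof.
move=> /andP[p0 p1] rho0; rewrite le_eqVlt => /predU1P[<-|m0].
  by rewrite (min_idPr (ltW rho0)) mulr_ge0 ?powR_ge0.
have split1 (a : R) : 0 < a -> a = a `^ (1 - p) * a `^ p.
  by move=> a0; rewrite -powRD ?subrK ?powRr1 ?(gt_eqF a0) ?implybT// ltW.
have [rm|mr] := leP rho m.
  rewrite {1}(split1 rho)// ler_wpM2l ?powR_ge0// ge0_ler_powR ?nnegrE//.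
    exact: ltW.
  exact: ltW.
rewrite {1}(split1 m)// ler_wpM2r ?powR_ge0// ge0_ler_powR ?nnegrE ?subr_ge0//;
  by rewrite ltW.
Qed.

(** On a class where [t] and the eigenvalue [l] are known up to a factor e, the weight [t^p l^(p-1)]
    equals [t (t l)^(p-1)]. The factor [(t l)^(1-p)] coming from the geometric mean cancels
    [(t l)^(p-1)], up to the ratio of opposite corners of the class, which is [exp (2 (1 - p))]. *)
Lemma frame_bin_le (R : realType) (I K J : finType) (x : I -> R) (y : K -> R)
    (alpha : I -> K -> R) (O : J -> K -> R) (mu : J -> R) (p a b : R)
    (S : pred I) (L : pred K) :
  0 <= p <= 1 -> frame_data x y alpha O mu ->
  (forall i, S i -> a <= x i <= a + 1) -> (forall k, L k -> b <= y k <= b + 1) ->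
  \sum_(i | S i) \sum_(k | L k)
      expR (p * x i + (p - 1) * y k) * alpha i k ^+ 2
    <= expR 2 * \sum_j mu j `^ p.
Proof.
move=> /andP[p0 p1] d xS yL.
have mu0 := frame_mu_ge0 d.
apply: (@le_trans _ _ (expR ((p - 1) * (a + b)) *
   \sum_(i | S i) \sum_(k | L k) expR (x i) * alpha i k ^+ 2)).
  rewrite mulr_sumr; apply: ler_sum => i /xS/andP[ax _].
  rewrite mulr_sumr; apply: ler_sum => k /yL/andP[bk _].
  rewrite mulrA ler_wpM2r ?sqr_ge0// -expRD ler_expR.
  have : (1 - p) * (a + b) <= (1 - p) * (x i + y k).
    by rewrite ler_wpM2l ?subr_ge0// lerD.
  nra.
have En : expR (a + 1) * expR (b + 1) = expR (a + b + 2).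
  by rewrite -expRD; congr expR; ring.
apply: (@le_trans _ _ (expR ((p - 1) * (a + b)) *
   \sum_j expR (a + b + 2) `^ (1 - p) * mu j `^ p)).
  rewrite ler_wpM2l ?expR_ge0//.
  apply: (@le_trans _ _ (\sum_j Num.min (expR (a + 1) * expR (b + 1)) (mu j))).
    apply: (@masked_energy_le _ _ _ _ (fun i => expR (x i))
      (fun k => expR (y k)) _ O); rewrite ?expR_ge0//.
    - by move=> i /xS/andP[_]; rewrite ler_expR.
    - by move=> k /yL/andP[_]; rewrite ler_expR.
    - exact: frame_row d.
    - exact: frame_col d.
    - exact: frame_upper d.
    - exact: frame_lower d.
  apply: ler_sum => j _; rewrite En min_le_powR ?p0 ?p1 ?expR_gt0//.
rewrite -mulr_sumr mulrA -expRM -expRD ler_wpM2r//.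
  by apply: sumr_ge0 => j _; exact: powR_ge0.
rewrite ler_expR; lra.
Qed.

(** This is (T) up to a constant that counts classes: both families of logarithms are cut into unit
    intervals, and the bound for one class is paid once per pair of intervals. *)
Lemma frame_crude_le (R : realType) (I K J : finType) (x : I -> R) (y : K -> R)
    (alpha : I -> K -> R) (O : J -> K -> R) (mu : J -> R) (p A B : R) :
  0 <= p <= 1 -> 0 <= A -> 0 <= B -> frame_data x y alpha O mu ->
  (forall i, `|x i| <= A) -> (forall k, `|y k| <= B) ->
  frame_lhs p x y alpha
    <= (2 * A + 1) * (2 * B + 1) * expR 2 * \sum_j mu j `^ p.
Proof.
move=> p01 A0 B0 d xA yB.
(* The intervals start at [-C], and [f i + C] lies in [[0, 2 C]], so its integer part takes at most
   [truncn (2 C) + 1] values. *)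
have bin (T : finType) (f : T -> R) (C : R) : 0 <= C ->
    (forall i, `|f i| <= C) ->
    exists (n : nat) (h : T -> 'I_n), n%:R <= 2 * C + 1 /\
      forall i (c : 'I_n), h i == c -> c%:R - C <= f i <= c%:R - C + 1.
  move=> C0 fC; pose n := Num.truncn (2 * C).
  have ge0 i : 0 <= f i + C by have := fC i; rewrite ler_norml => /andP[]; lra.
  have le2 i : f i + C <= 2 * C.
    by have := fC i; rewrite ler_norml => /andP[]; lra.
  exists n.+1, (fun i => inord (Num.truncn (f i + C))); split.
    have /truncn_itv/andP[] : 0 <= 2 * C by rewrite mulr_ge0.
    by rewrite -/n -addn1 natrD; lra.
  move=> i c /eqP/(congr1 val) /=; rewrite inordK => [<-|].
    by have /andP[] := truncn_itv (ge0 i); rewrite -addn1 natrD; lra.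
  by rewrite ltnS le_truncn.
have [nx [hx [nxA hxP]]] := bin _ _ _ A0 xA.
have [ny [hy [nyB hyP]]] := bin _ _ _ B0 yB.
set RH := \sum_j _.
have RH0 : 0 <= RH by apply: sumr_ge0 => j _; exact: powR_ge0.
rewrite /frame_lhs (partition_big hx predT)//=.
apply: (@le_trans _ _ (\sum_(a < nx) \sum_(b < ny) expR 2 * RH)).
  apply: ler_sum => a _.
  under eq_bigr => i _ do rewrite (partition_big hy predT)//=.
  rewrite exchange_big /=; apply: ler_sum => b _.
  apply: (@frame_bin_le _ _ _ _ _ _ _ O mu _ (a%:R - A) (b%:R - B)) => //.
    by move=> i /hxP.
  by move=> k /hyP.
rewrite !sumr_const !card_ord -[_ *+ ny]mulr_natl -[_ *+ nx]mulr_natl.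
rewrite mulrA -[leRHS]mulrA.
rewrite ler_wpM2r ?mulr_ge0 ?expR_ge0//.
by rewrite ler_pM.
Qed.

Lemma sum_pair_mul (R : realType) (I J : finType) (f : I -> R) (g : J -> R) :
  \sum_(q : I * J) f q.1 * g q.2 = (\sum_i f i) * (\sum_j g j).
Proof. by rewrite big_distrlr /= pair_bigA. Qed.

Lemma sum_pair (R : realType) (I J : finType) (f : I * J -> R) :
  \sum_q f q = \sum_i \sum_j f (i, j).
Proof. by rewrite pair_bigA; apply: eq_bigr => -[]. Qed.

(** The Kronecker square of a frame, in which logarithms add up. The upper constraint follows by
    applying it in one tensor factor and then in the other. The lower one concerns only the product
    vectors [O j1 (x) O j2], on which the sum factorizes. *)
Lemma frame_data_square (R : realType) (I K J : finType) (x : I -> R)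
    (y : K -> R) (alpha : I -> K -> R) (O : J -> K -> R) (mu : J -> R) :
  frame_data x y alpha O mu ->
  frame_data (fun i : I * I => x i.1 + x i.2) (fun k : K * K => y k.1 + y k.2)
    (fun i k => alpha i.1 k.1 * alpha i.2 k.2)
    (fun (j : J * J) k => O j.1 k.1 * O j.2 k.2) (fun j => mu j.1 * mu j.2).
Proof.
move=> d; have mu0 := frame_mu_ge0 d; split.
- move=> [j1 j2] [j1' j2'] /=.
  under eq_bigr => k _ do rewrite mulrACA.
  rewrite (sum_pair_mul (fun k => O j1 k * O j1' k)
    (fun k => O j2 k * O j2' k)) !(frame_row d) -natrM mulnb.
  by rewrite xpair_eqE.
- move=> [j1 j2] [j1' j2'] /=.
  under eq_bigr => k _ do rewrite mulrACA.
  rewrite (sum_pair_mul (fun k => O k j1 * O k j1')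
    (fun k => O k j2 * O k j2')) !(frame_col d) -natrM mulnb.
  by rewrite xpair_eqE.
- move=> z.
  rewrite !sum_pair /=.
  apply: (@le_trans _ _ (\sum_i' \sum_k expR (y k) *
    (\sum_k' alpha i' k' * z (k, k')) ^+ 2)).
    rewrite exchange_big /=; apply: ler_sum => i' _.
    apply: le_trans (frame_upper d _); apply: ler_sum => i _.
    rewrite le_eqVlt; apply/orP; left; apply/eqP; congr (_ ^+ 2).
    rewrite sum_pair /=.
    apply: eq_bigr => k _; rewrite mulr_sumr.
    by apply: eq_bigr => k' _; rewrite mulrA.
  rewrite exchange_big /=; apply: ler_sum => k _; rewrite -mulr_sumr.
  under [leRHS]eq_bigr => k' _ do rewrite expRD -mulrA.
  by rewrite -mulr_sumr ler_wpM2l ?expR_ge0// (frame_upper d).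
- move=> [j1 j2] /=.
  pose g j i := expR (x i) * (\sum_k alpha i k * O j k) ^+ 2.
  apply: (@le_trans _ _ ((\sum_i g j1 i) * (\sum_i g j2 i))); last first.
    rewrite ler_pM ?(frame_lower d)//; apply: sumr_ge0 => i _;
      by rewrite mulr_ge0 ?expR_ge0 ?sqr_ge0.
  rewrite -sum_pair_mul; apply: ler_sum => -[i1 i2] _ /=.
  under eq_bigr => k _ do rewrite mulrACA.
  rewrite (sum_pair_mul (fun k => alpha i1 k * O j1 k)
    (fun k => alpha i2 k * O j2 k)) /g expRD exprMn.
  by rewrite mulrACA.
Qed.

Lemma frame_lhs_square (R : realType) (I K : finType) (p : R) (x : I -> R)
    (y : K -> R) (alpha : I -> K -> R) :
  frame_lhs p (fun i : I * I => x i.1 + x i.2) (fun k : K * K => y k.1 + y k.2)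
    (fun i k => alpha i.1 k.1 * alpha i.2 k.2) = frame_lhs p x y alpha ^+ 2.
Proof.
rewrite /frame_lhs expr2 -sum_pair_mul; apply: eq_bigr => -[i1 i2] _ /=.
rewrite -sum_pair_mul; apply: eq_bigr => -[k1 k2] _ /=.
by rewrite exprMn [RHS]mulrACA -expRD; congr (expR _ * _); ring.
Qed.

(** Each squaring doubles the bounds on the logarithms, so after [n] squarings the class count is
    only quadratic in [N] while both sides of (T) are raised to the power [N]. *)
Lemma frame_power_le (R : realType) (I K J : finType) (x : I -> R) (y : K -> R)
    (alpha : I -> K -> R) (O : J -> K -> R) (mu : J -> R) (p A B : R) (n N : nat) :
  N = (2 ^ n)%N ->
  0 <= p <= 1 -> 0 <= A -> 0 <= B -> frame_data x y alpha O mu ->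
  (forall i, `|x i| <= A) -> (forall k, `|y k| <= B) ->
  frame_lhs p x y alpha ^+ N <= (2 * (N%:R * A) + 1) * (2 * (N%:R * B) + 1)
    * expR 2 * (\sum_j mu j `^ p) ^+ N.
Proof.
move=> NE p01.
elim: n N NE I K J x y alpha O mu A B => [|n IH] N NE I K J x y alpha O mu A B
    A0 B0 d xA yB.
  by rewrite NE !expr1 !mul1r; exact: frame_crude_le d xA yB.
have := IH _ erefl _ _ _ _ _ _ _ _ (A + A) (B + B) _ _ (frame_data_square d).
rewrite frame_lhs_square.
have -> : \sum_(j : J * J) (mu j.1 * mu j.2) `^ p = (\sum_j mu j `^ p) ^+ 2.
  rewrite expr2 -sum_pair_mul; apply: eq_bigr => j _.
  by rewrite powRM ?(frame_mu_ge0 d).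
rewrite -!exprM -expnS -NE => H.
have NC (C : R) : (2 ^ n)%:R * (C + C) = N%:R * C.
  by rewrite NE expnS natrM; ring.
rewrite !NC in H; apply: H; rewrite ?addr_ge0//.
- by move=> i; rewrite (le_trans (ler_normD _ _))// lerD.
- by move=> k; rewrite (le_trans (ler_normD _ _))// lerD.
Qed.

(** If [b < a], the exponential growth of [(a / b) ^+ N] beats every quadratic polynomial in [N];
    the cubic term of the exponential series is enough. *)
Lemma le_of_quadratic_powers (R : realType) (a b A B C : R) :
  0 <= a -> 0 <= b -> 0 <= A -> 0 <= B -> 0 <= C ->
  (forall n N : nat, N = (2 ^ n)%N ->
    a ^+ N <= (2 * (N%:R * A) + 1) * (2 * (N%:R * B) + 1) * C * b ^+ N) ->
  a <= b.
Proof.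
move=> a0 b0 A0 B0 C0 H; rewrite leNgt; apply/negP => ba.
have a_gt0 : 0 < a by exact: le_lt_trans ba.
move: b0; rewrite le_eqVlt => /predU1P[b0|b_gt0].
  have := H 0%N _ erefl; rewrite expn0 -b0 !expr1 mulr0.
  by rewrite leNgt a_gt0.
pose s := ln (a / b).
have s0 : 0 < s by rewrite ln_gt0// ltr_pdivlMr// mul1r.
have es : expR s = a / b by rewrite lnK// posrE divr_gt0.
pose D := (2 * A + 1) * (2 * B + 1) * C.
have D0 : 0 <= D by rewrite !mulr_ge0// addr_ge0// mulr_ge0.
(* The choice makes [N = 2 ^ n > n] exceed [6 D / s^3], against [(N s)^3 / 6 <= N^2 D]. *)
pose n := (Num.truncn (6 * D / s ^+ 3)).+1; pose N := (2 ^ n)%N.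
have N1 : 1 <= N%:R :> R by rewrite ler1n expn_gt0.
have : 6 * D / s ^+ 3 < N%:R.
  by rewrite (lt_trans (truncnS_gt _))// ltr_nat ltn_expl.
rewrite ltr_pdivrMr ?exprn_gt0//; apply/negP; rewrite -leNgt.
have eN : expR (N%:R * s) <= N%:R ^+ 2 * D.
  rewrite expRM_natl es expr_div_n ler_pdivrMr ?exprn_gt0//.
  apply: le_trans (H n _ erefl) _; rewrite -/N ler_wpM2r ?exprn_ge0 ?(ltW b_gt0)//.
  rewrite /D [leRHS]mulrA ler_wpM2r// expr2 [leRHS]mulrACA.
  have bound (E : R) : 0 <= E -> 2 * (N%:R * E) + 1 <= N%:R * (2 * E + 1).
    by move=> E0; nra.
  by rewrite ler_pM ?bound// addr_ge0// mulr_ge0// mulr_ge0.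
have Ns : 0 <= N%:R * s by rewrite mulr_ge0// ltW.
have := expR_ge1Dxn 2 Ns; have -> : 3`!%:R = 6 :> R by [].
move=> h; have : (N%:R * s) ^+ 3 / 6 <= N%:R ^+ 2 * D by lra.
rewrite ler_pdivrMr// exprMn => h3.
have N0 : 0 < N%:R ^+ 2 :> R by rewrite exprn_gt0// (lt_le_trans ltr01).
rewrite -(ler_pM2l N0).
have -> : N%:R ^+ 2 * (N%:R * s ^+ 3) = N%:R ^+ 3 * s ^+ 3 by ring.
by have -> : N%:R ^+ 2 * (6 * D) = N%:R ^+ 2 * D * 6 by ring.
Qed.

(** The tensor powers remove the constant. The sums of absolute values serve as uniform bounds on
    the logarithms. *)
Lemma frame_le (R : realType) (I K J : finType) (x : I -> R) (y : K -> R)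
    (alpha : I -> K -> R) (O : J -> K -> R) (mu : J -> R) (p : R) :
  0 <= p <= 1 -> frame_data x y alpha O mu ->
  \sum_i \sum_k expR (p * x i + (p - 1) * y k) * alpha i k ^+ 2
    <= \sum_j mu j `^ p.
Proof.
move=> p01 d.
have abs_le (T : finType) (f : T -> R) i : `|f i| <= \sum_i `|f i|.
  by rewrite (bigD1 i)//= lerDl sumr_ge0.
have abs_ge0 (T : finType) (f : T -> R) : 0 <= \sum_i `|f i|.
  by rewrite sumr_ge0.
apply: (le_of_quadratic_powers _ _ (abs_ge0 _ x) (abs_ge0 _ y) (expR_ge0 2)).
- apply: sumr_ge0 => i _; apply: sumr_ge0 => k _.
  by rewrite mulr_ge0 ?expR_ge0 ?sqr_ge0.
- by apply: sumr_ge0 => j _; exact: powR_ge0.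
- by move=> n N NE; apply: (frame_power_le NE) d _ _ => // i; exact: abs_le.
Qed.

(** * Real spectral theorem *)

Lemma symmetricmxP (R : realType) (n : nat) (M : 'M[R]_n) :
  reflect (M^T = M) (M \is symmetricmx).
Proof.
apply: (iffP (is_hermitianmxP _ _ _)); rewrite expr0 scale1r map_mx_id//.
Qed.

(** The characteristic polynomial splits over the reals by [eigenvaluesP], so the head of the
    nonempty list of roots is a real eigenvalue; its eigenvector is then normalized. *)
Lemma symmetric_eigenvector (R : realType) (n : nat) (M : 'M[R]_n.+1) :
  M^T = M -> exists (a : R) (v : 'rV_n.+1), v *m M = a *: v /\ v *m v^T = 1%:M.
Proof.
move=> /symmetricmxP/eigenvaluesP Ml.
have : size (eigenvalues M) = n.+1.
  by apply: succn_inj; rewrite -(size_prod_XsubC _ id) -Ml size_char_poly.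
case El : (eigenvalues M) => [//|a l] _.
have /eigenvalueP[v va v0] : eigenvalue M a.
  by rewrite eigenvalue_root_char Ml root_prod_XsubC El mem_head.
pose q := (v *m v^T) ord0 ord0.
have qE : v *m v^T = q%:M by rewrite [LHS]mx11_scalar.
have q0 : 0 < q.
  have qs : q = \sum_i v ord0 i ^+ 2.
    by rewrite /q mxE; apply: eq_bigr => i _; rewrite mxE expr2.
  rewrite lt_neqAle eq_sym qs sumr_ge0 ?andbT => [|i _]; last exact: sqr_ge0.
  apply: contra v0; rewrite psumr_eq0 => [/allP h|i _]; last exact: sqr_ge0.
  apply/eqP/matrixP => i j; rewrite ord1 [RHS]mxE; apply/eqP.
  by have := h j (mem_index_enum _); rewrite sqrf_eq0.
exists a, ((Num.sqrt q)^-1 *: v); split.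
  by rewrite -scalemxAl va scalerA mulrC -scalerA.
rewrite linearZ /= -scalemxAl -scalemxAr qE scalerA scale_scalar_mx.
by rewrite -invfM -expr2 sqr_sqrtr ?ltW// mulVf// gt_eqF.
Qed.

(** The Householder reflection along [v - e], or the identity when [v = e]. *)
Lemma reflection_to (R : realType) (n : nat) (v : 'rV[R]_n.+1) :
  v *m v^T = 1%:M ->
  exists H : 'M[R]_n.+1, [/\ H^T = H, H *m H = 1%:M & delta_mx ord0 ord0 *m H = v].
Proof.
move=> vv; set e : 'rV[R]_n.+1 := delta_mx ord0 ord0.
have ee : e *m e^T = 1%:M.
  by apply/matrixP => i j; rewrite !ord1 trmx_delta mul_delta_mx !mxE !eqxx.
pose b := (e *m v^T) ord0 ord0.
have ev : e *m v^T = b%:M by rewrite [LHS]mx11_scalar.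
have ve : v *m e^T = b%:M by rewrite -[LHS]trmxK trmx_mul trmxK ev tr_scalar_mx.
have [<-|evN] := eqVneq e v.
  by exists 1%:M; rewrite trmx1 !mulmx1.
have [z zE] : exists z, z = v - e by exists (v - e).
have zz : z *m z^T = (2 - 2 * b)%:M.
  rewrite zE linearB /= mulmxBl !mulmxBr vv ee ev ve -!raddfB; congr (_%:M).
  ring.
have ez : e *m z^T = (b - 1)%:M by rewrite zE linearB /= mulmxBr ee ev -raddfB.
have b1 : 2 - 2 * b != 0.
  apply: contra evN => /eqP c0; move: zz; rewrite c0 => zz.
  have : \sum_i z ord0 i ^+ 2 = 0.
    transitivity ((z *m z^T) ord0 ord0); last by rewrite zz mxE mul0rn.
    by rewrite [RHS]mxE; apply: eq_bigr => i _; rewrite [z^T _ _]mxE expr2.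
  move/eqP; rewrite psumr_eq0 => [/allP h|i _]; last exact: sqr_ge0.
  rewrite eq_sym -subr_eq0 -zE; apply/eqP/matrixP => i j.
  rewrite ord1 [RHS]mxE; apply/eqP.
  by have := h j (mem_index_enum _); rewrite sqrf_eq0.
pose r := 2 / (2 - 2 * b).
exists (1%:M - r *: (z^T *m z)); split.
- by rewrite linearB linearZ /= trmx1 trmx_mul trmxK.
- have PP : z^T *m z *m (z^T *m z) = (2 - 2 * b) *: (z^T *m z).
    by rewrite mulmxA -(mulmxA z^T) zz mul_mx_scalar -scalemxAl.
  rewrite mulmxBl !mulmxBr !mulmx1 mul1mx -scalemxAl -scalemxAr PP !scalerA.
  have -> : r * r * (2 - 2 * b) = r + r by rewrite /r; field.
  by rewrite scalerDl opprB addrK subrK.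
- rewrite mulmxBr mulmx1 -scalemxAr mulmxA ez mul_scalar_mx scalerA.
  have -> : r * (b - 1) = -1 by rewrite /r; field.
  by rewrite scaleN1r opprK zE addrC subrK.
Qed.

(** Deflation: a reflection carries a unit eigenvector to the first basis vector, which makes the
    matrix block diagonal, and the induction hypothesis handles the remaining block. *)
Lemma real_spectral (R : realType) (n : nat) (M : 'M[R]_n) : M^T = M ->
  exists (U : 'M[R]_n) (d : 'rV[R]_n),
    U *m U^T = 1%:M /\ M = U^T *m diag_mx d *m U.
Proof.
elim: n M => [|n IH] M MT.
  exists 1%:M, 0; split; first by rewrite trmx1 mulmx1.
  by apply/matrixP => -[].
have [a [v [vM vv]]] := symmetric_eigenvector MT.
have [H [HT HH eH]] := reflection_to vv.
have [N ND] : exists N : 'M[R]_(1 + n), N = H *m M *m H by exists (H *m M *m H).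
have NT : N^T = N by rewrite ND !trmx_mul HT MT mulmxA.
have MN : M = H *m N *m H.
  by rewrite ND !mulmxA HH mul1mx -mulmxA HH mulmx1.
have Nrow : delta_mx ord0 ord0 *m N = a *: (delta_mx ord0 ord0 : 'rV_(1 + n)).
  rewrite ND !mulmxA eH vM -scalemxAl; congr (_ *: _).
  by rewrite -eH -mulmxA HH mulmx1.
have N0 j : N ord0 j = a * (j == ord0)%:R.
  have := congr1 (fun A : 'M[R]_(1, 1 + n) => A ord0 j) Nrow.
  by rewrite -rowE !mxE eqxx.
have NE : N = block_mx a%:M 0 0 (drsubmx N).
  rewrite -{1}[N]submxK; congr block_mx.
  - by apply/matrixP => i j; rewrite !ord1 !mxE /= lshift0 N0 mulr1.
  - apply/matrixP => i j; rewrite !ord1 !mxE /= lshift0 N0.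
    by rewrite -(inj_eq val_inj) mulr0.
  - apply/matrixP => i j; rewrite !ord1 -NT !mxE /= lshift0 N0.
    by rewrite -(inj_eq val_inj) mulr0.
have [] := IH (drsubmx N); first by rewrite trmx_drsub NT.
move=> U [d [UU DE]].
pose V : 'M[R]_(1 + n) := block_mx 1%:M 0 0 U.
have VV : V *m V^T = 1%:M.
  rewrite /V tr_block_mx mulmx_block !trmx0 !mulmx0 !mul0mx trmx1 mulmx1 UU.
  by rewrite !addr0 add0r -scalar_mx_block.
have NV : N = V^T *m diag_mx (row_mx a%:M d) *m V.
  rewrite {1}NE {1}DE /V tr_block_mx diag_mx_row !mulmx_block.
  rewrite trmx1 !trmx0 !mul1mx !mulmx1.
  rewrite ?(mulmx0, mul0mx, addr0, add0r) ?(mulmx0, mul0mx, addr0, add0r).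
  congr block_mx; apply/matrixP => i j.
  by rewrite !ord1 !mxE.
exists (V *m H), (row_mx a%:M d); split.
  by rewrite trmx_mul HT mulmxA -(mulmxA V) HH mulmx1.
by rewrite MN NV trmx_mul HT !mulmxA.
Qed.

Lemma char_poly_spectral (R : realType) (n : nat) (U : 'M[R]_n) (d : 'rV[R]_n) :
  U *m U^T = 1%:M ->
  char_poly (U^T *m diag_mx d *m U) = \prod_i ('X - (d ord0 i)%:P).
Proof.
move=> UU; have U'U := mulmx1C UU.
have -> : char_poly (U^T *m diag_mx d *m U) = char_poly (diag_mx d).
  rewrite /char_poly.
  have -> : char_poly_mx (U^T *m diag_mx d *m U) = map_mx (@polyC _) U^T
              *m char_poly_mx (diag_mx d) *m map_mx (@polyC _) U.
    rewrite /char_poly_mx !map_mxM mulmxBr mulmxBl; congr (_ - _).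
    by rewrite scalar_mxC -mulmxA -map_mxM U'U map_mx1 mulmx1.
  by rewrite !det_mulmx mulrC mulrA -det_mulmx -map_mxM UU map_mx1 det1 mul1r.
rewrite char_poly_trig ?diag_mx_is_trig//.
by apply: eq_bigr => i _; rewrite mxE eqxx mulr1n.
Qed.

(** Unique factorization of the characteristic polynomial makes the unspecified list [eigenvalues] a
    permutation of the entries of [d]. *)
Lemma big_eigenvalues (R : realType) (n : nat) (U : 'M[R]_n) (d : 'rV[R]_n)
    (f : R -> R) :
  U *m U^T = 1%:M ->
  \sum_(x <- eigenvalues (U^T *m diag_mx d *m U)) f x = \sum_i f (d ord0 i).
Proof.
move=> UU; set M := _ *m U.
have /eigenvaluesP : M \is symmetricmx.
  by apply/symmetricmxP; rewrite !trmx_mul trmxK tr_diag_mx mulmxA.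
rewrite char_poly_spectral// => h.
have /prod_XsubC_eq p : \prod_(x <- [seq d ord0 i | i <- enum 'I_n]) ('X - x%:P)
    = \prod_(x <- eigenvalues M) ('X - x%:P) by rewrite big_map big_enum.
by rewrite -(perm_big _ p) big_map big_enum.
Qed.

(** * The trace power inequality *)

Definition qf (R : realType) (m : nat) (M : 'M[R]_m) (z : 'cV[R]_m) : R :=
  (z^T *m M *m z) ord0 ord0.

Lemma qf_spectral (R : realType) (m : nat) (U : 'M[R]_m) (d : 'rV[R]_m)
    (z : 'cV[R]_m) :
  qf (U^T *m diag_mx d *m U) z = \sum_r d ord0 r * ((U *m z) r ord0) ^+ 2.
Proof.
rewrite /qf !mulmxA -trmx_mul -mulmxA mxE; apply: eq_bigr => r _.
by rewrite mul_mx_diag !mxE; ring.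
Qed.

Lemma qfD (R : realType) (m : nat) (M N : 'M[R]_m) (z : 'cV[R]_m) :
  qf (M + N) z = qf M z + qf N z.
Proof. by rewrite /qf mulmxDr mulmxDl mxE. Qed.

Lemma qfZ (R : realType) (m : nat) (a : R) (M : 'M[R]_m) (z : 'cV[R]_m) :
  qf (a *: M) z = a * qf M z.
Proof. by rewrite /qf -scalemxAr -scalemxAl mxE. Qed.

Lemma qf0 (R : realType) (m : nat) (z : 'cV[R]_m) : qf 0 z = 0.
Proof. by rewrite /qf mulmx0 mul0mx mxE. Qed.

Lemma qf_sum (R : realType) (m : nat) (I : finType) (M : I -> 'M[R]_m)
    (z : 'cV[R]_m) : qf (\sum_i M i) z = \sum_i qf (M i) z.
Proof.
by apply: (big_morph (fun A => qf A z)) => [A B|]; [exact: qfD|exact: qf0].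
Qed.

Lemma psdmx_sym (R : realType) (m : nat) (M : 'M[R]_m) : psdmx M -> M^T = M.
Proof. by case=> /symmetricmxP. Qed.

Lemma psdmx_qf_ge0 (R : realType) (m : nat) (M : 'M[R]_m) (z : 'cV[R]_m) :
  psdmx M -> 0 <= qf M z.
Proof. by case=> _; apply. Qed.

Lemma psdmxD (R : realType) (m : nat) (M N : 'M[R]_m) :
  psdmx M -> psdmx N -> psdmx (M + N).
Proof.
move=> hM hN; split.
  by apply/symmetricmxP; rewrite linearD /= !psdmx_sym.
by move=> z; rewrite -/(qf _ z) qfD addr_ge0// psdmx_qf_ge0.
Qed.

Lemma psdmxZ (R : realType) (m : nat) (a : R) (M : 'M[R]_m) :
  0 <= a -> psdmx M -> psdmx (a *: M).
Proof.
move=> a0 hM; split.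
  by apply/symmetricmxP; rewrite linearZ /= psdmx_sym.
by move=> z; rewrite -/(qf _ z) qfZ mulr_ge0// psdmx_qf_ge0.
Qed.

Lemma psdmx0 (R : realType) (m : nat) : psdmx (0 : 'M[R]_m).
Proof.
split; first by apply/symmetricmxP; rewrite trmx0.
by move=> z; rewrite -/(qf _ z) qf0.
Qed.

Lemma psdmx_sum (R : realType) (m : nat) (I : finType) (M : I -> 'M[R]_m) :
  (forall i, psdmx (M i)) -> psdmx (\sum_i M i).
Proof.
move=> hM; elim/big_ind: _ => //; [exact: psdmx0|exact: psdmxD].
Qed.

(** Both witnesses are packed into one pair so that [choice] can select a decomposition for a whole
    family of matrices. *)
Lemma psdmx_spectral (R : realType) (m : nat) (M : 'M[R]_m) : psdmx M ->
  exists Ud : 'M[R]_m * 'rV[R]_m, [/\ Ud.1 *m Ud.1^T = 1%:M,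
    M = Ud.1^T *m diag_mx Ud.2 *m Ud.1 & forall i, 0 <= Ud.2 ord0 i].
Proof.
move=> hM; have [U [d [UU ME]]] := real_spectral (psdmx_sym hM).
exists (U, d); split=> //= i.
have := psdmx_qf_ge0 (col i U^T) hM.
rewrite ME qf_spectral (bigD1 i)//= [X in _ + X]big1 => [|r ri].
  by rewrite addr0 colE mulmxA UU mul1mx !mxE !eqxx expr1n mulr1.
by rewrite colE mulmxA UU mul1mx !mxE (negbTE ri) expr0n mulr0.
Qed.

(* The trace of W^(p-1) P for W = V^T diag(lam) V. *)
Definition gain (R : realType) (m : nat) (V : 'M[R]_m) (lam : 'rV[R]_m) (p : R)
    (P : 'M[R]_m) : R :=
  \sum_k (lam ord0 k) `^ (p - 1) * qf P (col k V^T).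

(** Inequality (T) for matrices. Each [P i] is split into rank-one pieces by its spectral
    decomposition, the pieces are written in the eigenbasis [V] of [W], and [O] is the change of
    basis from [V] to the eigenbasis of [N]. *)
Lemma trace_power_ge (R : realType) (m : nat) (I : finType) (p : R)
    (P : I -> 'M[R]_m) (t : I -> R) (V N : 'M[R]_m) (lam : 'rV[R]_m) :
  0 < p <= 1 -> V *m V^T = 1%:M -> (forall k, 0 < lam ord0 k) ->
  (forall i, psdmx (P i)) -> (forall i, 0 <= t i) -> psdmx N ->
  (forall z, \sum_i qf (P i) z <= qf (V^T *m diag_mx lam *m V) z) ->
  (forall z, \sum_i t i * qf (P i) z <= qf N z) ->
  \sum_i (t i) `^ p * gain V lam p (P i) <= tracepow p N.
Proof.
move=> /andP[p0 p1] VV lam0 hP t0 hN upper lower.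
have V'V := mulmx1C VV.
have [Ud Udp] := choice (fun i => psdmx_spectral (hP i)).
have [[W mu] /= [WW NE mu0]] := psdmx_spectral hN.
have W'W := mulmx1C WW.
rewrite /tracepow gt_eqF// NE big_eigenvalues//.
pose O j k := (W *m V^T) j k.
pose alpha (q : I * 'I_m) k :=
  if t q.1 == 0 then 0
  else Num.sqrt ((Ud q.1).2 ord0 q.2) * ((Ud q.1).1 *m V^T) q.2 k.
have alphaz (i : I) (z : 'cV[R]_m) :
    \sum_r (\sum_k alpha (i, r) k * z k ord0) ^+ 2
    = if t i == 0 then 0 else qf (P i) (V^T *m z).
  rewrite /alpha /=; case: ifP => _.
    rewrite big1// => r _; rewrite big1 ?expr0n// => k _; exact: mul0r.
  have [_ PE d0] := Udp i; rewrite PE qf_spectral; apply: eq_bigr => r _.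
  rewrite mulmxA [((_ *m z) r _)]mxE.
  under eq_bigr => k _ do rewrite -mulrA.
  by rewrite -mulr_sumr exprMn sqr_sqrtr.
have d : @frame_data R _ _ _ (fun q : I * 'I_m => ln (t q.1))
    (fun k => ln (lam ord0 k)) alpha O (fun j => mu ord0 j).
  split.
  - move=> j j'.
    transitivity ((W *m V^T *m (W *m V^T)^T) j j').
      by rewrite [RHS]mxE; apply: eq_bigr => k _; rewrite [_^T _ _]mxE.
    by rewrite trmx_mul trmxK mulmxA -(mulmxA W) V'V mulmx1 WW mxE.
  - move=> k l.
    transitivity (((W *m V^T)^T *m (W *m V^T)) k l).
      by rewrite [RHS]mxE; apply: eq_bigr => j _; rewrite [_^T _ _]mxE.
    by rewrite trmx_mul trmxK mulmxA -(mulmxA V) W'W mulmx1 VV mxE.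
  - move=> z; pose zc := \col_k z k.
    rewrite sum_pair; apply: (@le_trans _ _ (\sum_i qf (P i) (V^T *m zc))).
      apply: ler_sum => i _.
      rewrite (_ : \sum_r _ = \sum_r (\sum_k alpha (i, r) k * zc k ord0) ^+ 2).
        by rewrite alphaz; case: ifP => // _; exact: psdmx_qf_ge0.
      by apply: eq_bigr => r _; congr (_ ^+ 2); apply: eq_bigr => k _; rewrite mxE.
    apply: le_trans (upper _) _; rewrite qf_spectral mulmxA VV mul1mx.
    by apply: ler_sum => k _; rewrite mxE lnK// posrE.
  (* In the original coordinates, row [j] of [O] is the [j]-th eigenvector of [N], where the form of
     [N] takes the value [mu j]. *)
  - move=> j; pose zc := \col_k O j k.
    have Vz : V^T *m zc = col j W^T.
      have -> : zc = V *m col j W^T.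
        apply/matrixP => k ?; rewrite [LHS]mxE /O [LHS]mxE [RHS]mxE.
        by apply: eq_bigr => l _; rewrite !mxE mulrC.
      by rewrite mulmxA V'V mul1mx.
    rewrite sum_pair; apply: (@le_trans _ _ (\sum_i t i * qf (P i) (V^T *m zc))).
      apply: ler_sum => i _ /=; rewrite -mulr_sumr.
      rewrite (_ : \sum_r _ = \sum_r (\sum_k alpha (i, r) k * zc k ord0) ^+ 2).
        rewrite alphaz; case: ifPn => [/eqP ->|ti]; first by rewrite mulr0 mul0r.
        by rewrite lnK// posrE lt_neqAle eq_sym ti t0.
      by apply: eq_bigr => r _; congr (_ ^+ 2); apply: eq_bigr => k _; rewrite mxE.
    apply: le_trans (lower _) _; rewrite Vz NE qf_spectral colE mulmxA WW mul1mx.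
    rewrite (bigD1 j)//= [X in _ + X]big1 => [|r rj].
      by rewrite addr0 !mxE !eqxx expr1n mulr1.
    by rewrite !mxE (negbTE rj) expr0n mulr0.
apply: le_trans (frame_le _ d); last by rewrite (ltW p0).
rewrite sum_pair; apply: ler_sum => i _ /=.
have [ti0|ti] := eqVneq (t i) 0.
  rewrite ti0 powR0 ?gt_eqF// mul0r; apply: sumr_ge0 => r _.
  by apply: sumr_ge0 => k _; rewrite mulr_ge0 ?expR_ge0 ?sqr_ge0.
rewrite exchange_big /gain mulr_sumr; apply: ler_sum => k _ /=.
have ti_gt0 : 0 < t i by rewrite lt_neqAle eq_sym ti t0.
have -> : expR (p * ln (t i) + (p - 1) * ln (lam ord0 k))
    = t i `^ p * lam ord0 k `^ (p - 1).
  by rewrite expRD (mulrC p) (mulrC (p - 1)) !expRM !lnK// posrE.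
rewrite -mulr_sumr mulrA ler_wpM2l ?mulr_ge0 ?powR_ge0//.
have := alphaz i (delta_mx k ord0); rewrite (negbTE ti) -colE => <-.
apply: ler_sum => r _; rewrite (bigD1 k)//= [X in _ + X]big1 => [|l lk].
  by rewrite addr0 !mxE !eqxx mulr1.
by rewrite !mxE (negbTE lk) mulr0.
Qed.

(** * Scalar powers, gains and power traces *)

Lemma powR_bernoulli (R : realType) (a p : R) : 0 < a -> 0 <= p <= 1 ->
  a `^ p <= 1 + p * (a - 1).
Proof.
move=> a0 /andP[p0 p1]; have -> : a `^ p = expR (p * ln a).
  by rewrite mulrC expRM lnK.
have aE : expR (ln a) = a by rewrite lnK.
set l := ln a in aE *; set s := p * l.
(* Tangents of [expR] at [s], evaluated at [ln a] and [0]. *)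
have h1 : expR s * (1 + (l - s)) <= a.
  have -> : a = expR s * expR (l - s) by rewrite -expRD subrKC.
  by rewrite ler_wpM2l ?expR_ge0 ?expR_ge1Dx.
have h2 : expR s * (1 - s) <= 1.
  by rewrite -[leRHS](expRxMexpNx_1 s) ler_wpM2l ?expR_ge0 ?expR_ge1Dx.
have := lerD (ler_wpM2l p0 h1) (ler_wpM2l (_ : 0 <= 1 - p) h2).
rewrite subr_ge0 => /(_ p1).
have -> : p * (expR s * (1 + (l - s))) + (1 - p) * (expR s * (1 - s)) = expR s.
  by rewrite /s; ring.
lra.
Qed.

Lemma powR_inv_base (R : realType) (a p : R) : 0 < a ->
  a^-1 `^ p = (a `^ p)^-1.
Proof.
by move=> a0; rewrite -(powR_inv1 (ltW a0)) -powRrM mulN1r powRN.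
Qed.

(** Stands in for letting the perturbation size tend to zero in the optimality conditions. *)
Lemma le_of_small_error (R : realType) (a b C : R) : 0 <= C ->
  (forall e, 0 < e < 1 -> a <= b + e * C) -> a <= b.
Proof.
move=> C0 h; apply/ler_addgt0Pr => e e0.
have d0 : 0 < C + e + 1 by lra.
have := h (e / (C + e + 1)); rewrite divr_gt0//= ltr_pdivrMr// mul1r.
have -> : e < C + e + 1 by lra.
move=> /(_ isT) /le_trans; apply; rewrite lerD2l.
rewrite mulrAC ler_pdivrMr// ler_wpM2l ?ltW//; lra.
Qed.

Lemma gainD (R : realType) (m : nat) (V : 'M[R]_m) (lam : 'rV[R]_m) (p : R)
    (P Q : 'M[R]_m) : gain V lam p (P + Q) = gain V lam p P + gain V lam p Q.
Proof.
by rewrite /gain -big_split; apply: eq_bigr => k _; rewrite qfD mulrDr.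
Qed.

Lemma gainZ (R : realType) (m : nat) (V : 'M[R]_m) (lam : 'rV[R]_m) (p a : R)
    (P : 'M[R]_m) : gain V lam p (a *: P) = a * gain V lam p P.
Proof.
by rewrite /gain mulr_sumr; apply: eq_bigr => k _; rewrite qfZ mulrCA.
Qed.

Lemma gain_sum (R : realType) (m : nat) (V : 'M[R]_m) (lam : 'rV[R]_m) (p : R)
    (I : finType) (P : I -> 'M[R]_m) :
  gain V lam p (\sum_i P i) = \sum_i gain V lam p (P i).
Proof.
apply: (big_morph (gain V lam p)) => [Q Q'|]; first exact: gainD.
by rewrite /gain big1// => k _; rewrite qf0 mulr0.
Qed.

Lemma gain_ge0 (R : realType) (m : nat) (V : 'M[R]_m) (lam : 'rV[R]_m) (p : R)
    (P : 'M[R]_m) : psdmx P -> 0 <= gain V lam p P.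
Proof.
by move=> hP; apply: sumr_ge0 => k _; rewrite mulr_ge0 ?powR_ge0 ?psdmx_qf_ge0.
Qed.

Lemma mulmx_col_tr (R : realType) (m : nat) (V : 'M[R]_m) k r :
  V *m V^T = 1%:M -> (V *m col k V^T) r ord0 = (r == k)%:R.
Proof.
by move=> VV; rewrite colE mulmxA VV mul1mx !mxE eqxx andbT.
Qed.

Lemma gain_spectral (R : realType) (m : nat) (V : 'M[R]_m) (lam : 'rV[R]_m)
    (p : R) : V *m V^T = 1%:M -> (forall k, 0 < lam ord0 k) ->
  gain V lam p (V^T *m diag_mx lam *m V) = \sum_k lam ord0 k `^ p.
Proof.
move=> VV lam0; apply: eq_bigr => k _; rewrite qf_spectral.
rewrite (bigD1 k)//= [X in _ * (_ + X)]big1 => [|r rk]; last first.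
  by rewrite mulmx_col_tr// (negbTE rk) expr0n mulr0.
rewrite mulmx_col_tr// eqxx expr1n mulr1 addr0.
rewrite -{2}[lam ord0 k]powRr1 ?ltW// -powRD ?subrK//.
by rewrite (gt_eqF (lam0 k)) implybT.
Qed.

Lemma tracepow_spectral (R : realType) (m : nat) (V : 'M[R]_m) (lam : 'rV[R]_m)
    (p : R) : p != 0 -> V *m V^T = 1%:M ->
  tracepow p (V^T *m diag_mx lam *m V) = \sum_k lam ord0 k `^ p.
Proof. by move=> p0 VV; rewrite /tracepow (negbTE p0) big_eigenvalues. Qed.

Lemma tracepow_ge0 (R : realType) (m : nat) (p : R) (M : 'M[R]_m) :
  0 <= tracepow p M.
Proof.
rewrite /tracepow; case: ifP => _; first exact: ler0n.
by apply: sumr_ge0 => x _; exact: powR_ge0.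
Qed.

Lemma tracepowZ (R : realType) (m : nat) (p a : R) (M : 'M[R]_m) :
  p != 0 -> 0 <= a -> psdmx M -> tracepow p (a *: M) = a `^ p * tracepow p M.
Proof.
move=> p0 a0 /psdmx_spectral[[V lam] /= [VV -> lam0]].
rewrite scalemxAl scalemxAr -linearZ /= !tracepow_spectral// mulr_sumr.
by apply: eq_bigr => k _; rewrite mxE powRM.
Qed.

Lemma tracepow1 (R : realType) (m : nat) (M : 'M[R]_m) :
  psdmx M -> tracepow 1 M = \tr M.
Proof.
move=> /psdmx_spectral[[V lam] /= [VV -> lam0]].
rewrite tracepow_spectral ?oner_eq0// mxtrace_mulC mulmxA VV mul1mx.
by rewrite mxtrace_diag; apply: eq_bigr => k _; rewrite powRr1.
Qed.

(** The instance of (T) with a single matrix [P = W] and multiplier 1. *)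
Lemma tracepow_mono (R : realType) (m : nat) (p : R) (V N : 'M[R]_m)
    (lam : 'rV[R]_m) : 0 < p <= 1 -> V *m V^T = 1%:M ->
  (forall k, 0 < lam ord0 k) -> psdmx N ->
  (forall z, qf (V^T *m diag_mx lam *m V) z <= qf N z) ->
  \sum_k lam ord0 k `^ p <= tracepow p N.
Proof.
move=> p01 VV lam0 hN WN; set W := V^T *m _ *m V in WN.
have hW : psdmx W.
  split; first by apply/symmetricmxP; rewrite !trmx_mul trmxK tr_diag_mx mulmxA.
  move=> z; rewrite -/(qf _ z) qf_spectral; apply: sumr_ge0 => k _.
  by rewrite mulr_ge0 ?sqr_ge0 ?ltW.
have := @trace_power_ge R m 'I_1 p (fun=> W) (fun=> 1) V N lam p01 VV lam0
  (fun=> hW) (fun=> ler01) hN.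
rewrite !big_ord1 powR1 mul1r gain_spectral//; apply => z; rewrite big_ord1//.
by rewrite mul1r.
Qed.

Lemma psdmx_full_rank_lower (R : realType) (m : nat) (S : 'M[R]_m) :
  psdmx S -> \rank S = m ->
  exists2 kappa : R, 0 < kappa &
    forall z : 'cV[R]_m, kappa * \sum_k z k ord0 ^+ 2 <= qf S z.
Proof.
move=> /psdmx_spectral[[U d] /= [UU SE d0]] rS.
have Su : S \in unitmx by rewrite -row_free_unit -row_leq_rank rS.
have dn0 k : d ord0 k != 0.
  move: Su; rewrite SE !unitmx_mul => /andP[/andP[_ +] _].
  rewrite unitmxE det_diag unitfE => /prodf_neq0; apply => //.
have U'U := mulmx1C UU.
have dpos k : 0 < d ord0 k by rewrite lt_neqAle eq_sym dn0 d0.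
have q0 : 0 < 1 + \sum_k (d ord0 k)^-1.
  by rewrite ltr_wpDr// sumr_ge0// => k _; rewrite invr_ge0.
(* A positive number below every eigenvalue, obtained without taking a minimum. *)
exists (1 + \sum_k (d ord0 k)^-1)^-1; first by rewrite invr_gt0.
move=> z; rewrite SE qf_spectral.
have -> : \sum_k z k ord0 ^+ 2 = \sum_k ((U *m z) k ord0) ^+ 2.
  by rewrite -!cV_sqr_sum trmx_mul mulmxA -(mulmxA _ U^T) U'U mulmx1.
rewrite mulr_sumr; apply: ler_sum => k _; rewrite ler_wpM2r ?sqr_ge0//.
rewrite invf_ple ?posrE// (bigD1 k)//= addrCA lerDl addr_ge0// sumr_ge0// => j _.
by rewrite invr_ge0.
Qed.

Lemma info_mx_psd (R : realType) (m s : nat) (M : 'I_s -> 'M[R]_m)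
    (w : 'I_s -> R) : (forall i, psdmx (M i)) -> (forall i, 0 <= w i) ->
  psdmx (info_mx M w).
Proof. by move=> hM w0; apply: psdmx_sum => i; exact: psdmxZ. Qed.

Lemma qf_info_mx (R : realType) (m s : nat) (M : 'I_s -> 'M[R]_m)
    (w : 'I_s -> R) z : qf (info_mx M w) z = \sum_i w i * qf (M i) z.
Proof. by rewrite qf_sum; apply: eq_bigr => i _; rewrite qfZ. Qed.

Lemma Phi_le_tracepow (R : realType) (m : nat) (p : R) (X Y : 'M[R]_m) :
  (0 < m)%N -> 0 < p -> Phi p X <= Phi p Y -> tracepow p X <= tracepow p Y.
Proof.
move=> m0 p0; rewrite /Phi gt_eqF//; apply: contraTT; rewrite -!ltNge => h.
have mi : 0 < m%:R^-1 :> R by rewrite invr_gt0 ltr0n.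
rewrite gt0_ltr_powR ?invr_gt0 ?nnegrE ?mulr_ge0 ?tracepow_ge0 ?(ltW mi)//.
by rewrite ltr_pM2l.
Qed.

(** * Optimality conditions *)

Lemma feasible_uniform (R : realType) (s : nat) (c : 'I_s -> R) (B : R) :
  (forall i, 0 <= c i) -> 0 < B ->
  exists2 eta : R, 0 < eta & feasible c B (fun=> eta).
Proof.
move=> c0 B0; have C0 : 0 <= \sum_i c i by exact: sumr_ge0.
(* The added 1 keeps the denominator positive when all costs vanish. *)
exists (B / (1 + \sum_i c i)); first by rewrite divr_gt0// ltr_pwDl.
split=> [_|]; first by rewrite divr_ge0 ?(ltW B0)// addr_ge0.
rewrite -mulr_suml mulrCA ler_piMr ?(ltW B0)// ler_pdivrMr ?ltr_pwDl// mul1r.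
by rewrite lerDr.
Qed.

Lemma info_mx_comb (R : realType) (m s : nat) (M : 'I_s -> 'M[R]_m)
    (a b : R) (v w : 'I_s -> R) :
  info_mx M (fun i => a * v i + b * w i) = a *: info_mx M v + b *: info_mx M w.
Proof.
rewrite /info_mx !scaler_sumr -big_split; apply: eq_bigr => i _ /=.
by rewrite scalerDl !scalerA.
Qed.

Lemma info_mx_const (R : realType) (m s : nat) (M : 'I_s -> 'M[R]_m) (a : R) :
  info_mx M (fun=> a) = a *: \sum_i M i.
Proof. by rewrite /info_mx scaler_sumr. Qed.

Definition drop_weight (R : realType) (s : nat) (w : 'I_s -> R) (i : 'I_s)
  (d : R) (j : 'I_s) : R := if j == i then (1 - d) * w j else w j.

Lemma info_mx_drop (R : realType) (m s : nat) (M : 'I_s -> 'M[R]_m)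
    (w : 'I_s -> R) (i : 'I_s) (d : R) :
  info_mx M (drop_weight w i d) = info_mx M w - (d * w i) *: M i.
Proof.
rewrite /info_mx (bigD1 i)//= [in RHS](bigD1 i)//= /drop_weight eqxx.
rewrite mulrBl mul1r scalerBl addrAC; congr (_ + _ - _).
by apply: eq_bigr => j /negbTE ->.
Qed.

Lemma drop_weight_ge0 (R : realType) (s : nat) (w : 'I_s -> R) (i : 'I_s)
    (d : R) : (forall j, 0 <= w j) -> 0 <= d <= 1 ->
  forall j, 0 <= drop_weight w i d j.
Proof.
move=> w0 /andP[d0 d1] j; rewrite /drop_weight; case: ifP => // _.
by rewrite mulr_ge0// subr_ge0.
Qed.

(* Dropping a fraction [d] of [w i] frees the fraction [d * w i * c i / B] of
   the budget, which is reinvested by scaling the whole design up. *)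
Lemma feasible_rescaled_drop (R : realType) (s : nat) (c : 'I_s -> R) (B : R)
    (w : 'I_s -> R) (i : 'I_s) (d : R) :
  (forall i, 0 <= c i) -> 0 < B -> feasible c B w -> 0 <= d < 1 ->
  let x := d * w i * c i / B in
  0 <= x < 1 /\ feasible c B (fun j => (1 - x)^-1 * drop_weight w i d j).
Proof.
move=> c0 B0 [w0 wB] /andP[d0 d1] x.
have cw : c i * w i <= B.
  by rewrite (le_trans _ wB)// (bigD1 i)//= lerDl sumr_ge0// => j _; exact: mulr_ge0.
have x0 : 0 <= x by rewrite /x divr_ge0 ?(ltW B0)// !mulr_ge0.
have x1 : x < 1.
  rewrite /x ltr_pdivrMr// mul1r -mulrA (mulrC (w i)).
  have [->|dn] := eqVneq d 0; first by rewrite mul0r.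
  by apply: (@le_lt_trans _ _ (d * B)); rewrite ?ler_wpM2l// gtr_pMl.
split; first by rewrite x0.
have x1' : 0 < 1 - x by rewrite subr_gt0.
split=> [j|].
  by rewrite mulr_ge0 ?invr_ge0 ?(ltW x1')// drop_weight_ge0// d0 ltW.
under eq_bigr => j _ do rewrite mulrCA.
rewrite -mulr_sumr mulrC ler_pdivrMr//.
have -> : \sum_j c j * drop_weight w i d j = \sum_j c j * w j - d * w i * c i.
  rewrite (bigD1 i)//= [in RHS](bigD1 i)//= /drop_weight eqxx.
  rewrite addrAC; congr (_ + _); first ring.
  by apply: eq_bigr => j /negbTE ->.
by rewrite mulrBr mulr1 /x mulrCA mulfV ?gt_eqF// mulr1 lerB.
Qed.

Lemma optimal_tracepow (R : realType) (m s : nat) (M : 'I_s -> 'M[R]_m)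
    (c : 'I_s -> R) (B p : R) (w : 'I_s -> R) :
  (0 < m)%N -> 0 < p -> optimal_design M c B p w ->
  forall v, feasible c B v -> phi M p v <= phi M p w.
Proof. by move=> m0 p0 [_ h] v /h; exact: Phi_le_tracepow. Qed.

(* The derivative of [x |-> x `^ p] is infinite at [0], so moving a little
   mass to a uniform design would improve a singular one. *)
Lemma optimal_info_mx_pd (R : realType) (m s : nat) (M : 'I_s -> 'M[R]_m)
    (c : 'I_s -> R) (B p : R) (w : 'I_s -> R) (V : 'M[R]_m) (lam : 'rV[R]_m) :
  (0 < m)%N -> (forall i, psdmx (M i)) -> \rank (\sum_i M i)%R = m ->
  (forall i, 0 <= c i) -> 0 < B -> 0 < p < 1 ->
  optimal_design M c B p w -> V *m V^T = 1%:M ->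
  info_mx M w = V^T *m diag_mx lam *m V -> (forall k, 0 <= lam ord0 k) ->
  forall k, 0 < lam ord0 k.
Proof.
move=> m0 hM rS c0 B0 /andP[p0 p1] hw VV WE lam0 k0.
rewrite lt_neqAle lam0 andbT eq_sym; apply/negP => /eqP lk0.
have [[w0 wB] _] := hw.
have [eta eta0 [_ etaB]] := feasible_uniform c0 B0.
have [kap kap0 kapS] := psdmx_full_rank_lower (psdmx_sum hM) rS.
set f := phi M p w; have fE : f = \sum_k lam ord0 k `^ p.
  by rewrite /f /phi WE tracepow_spectral ?gt_eqF.
have f0 : 0 <= f by exact: tracepow_ge0.
pose kp := eta * kap; have kp0 : 0 < kp by exact: mulr_gt0.
(* A fraction [e] of the uniform design is mixed in. The form of the mixture dominates the one with
   eigenvalues [(1 - e) lam + e kp]: the zero eigenvalue gains [(e kp)^p], and the others lose at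
   most [e f] in total because [1 - e <= (1 - e)^p]. *)
have key e : 0 < e < 1 -> e `^ p * kp `^ p <= e * f.
  move=> /andP[e0 e1]; have e1' : 0 < 1 - e by rewrite subr_gt0.
  pose v i := (1 - e) * w i + e * eta.
  have fv : feasible c B v.
    split=> [i|].
      by rewrite /v addr_ge0 ?mulr_ge0 ?(ltW e0) ?(ltW e1') ?(ltW eta0).
    rewrite /v; under eq_bigr => i _ do
      rewrite mulrDr (mulrCA _ (1 - e)) (mulrCA _ e).
    rewrite big_split -!mulr_sumr /=.
    have := lerD (ler_wpM2l (ltW e1') wB) (ler_wpM2l (ltW e0) etaB).
    by rewrite -mulrDl subrK mul1r.
  have := optimal_tracepow m0 p0 hw fv; rewrite -/f /phi.
  have -> : info_mx M v = (1 - e) *: info_mx M w + (e * eta) *: \sum_i M i.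
    by rewrite (info_mx_comb M _ _ w (fun=> eta)) info_mx_const scalerA.
  pose lam' : 'rV[R]_m := \row_k ((1 - e) * lam ord0 k + e * kp).
  have lam'0 k : 0 < lam' ord0 k.
    by rewrite mxE ltr_wpDl ?mulr_ge0 ?mulr_gt0// ltW.
  have h := @tracepow_mono R m p V
    ((1 - e) *: info_mx M w + (e * eta) *: \sum_i M i) lam' _ VV lam'0 _ _.
  move=> /(le_trans (h _ _ _)) hf.
  have {hf h} : \sum_k lam' ord0 k `^ p <= f.
    apply: hf; first by rewrite p0 ltW.
      apply: psdmxD; apply: psdmxZ; rewrite ?mulr_ge0 ?ltW//.
        exact: info_mx_psd.
      exact: psdmx_sum.
    move=> z; rewrite qfD !qfZ WE !qf_spectral.
    under eq_bigr => k _ do rewrite mxE mulrDl -(mulrA (1 - e)).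
    rewrite big_split -!mulr_sumr /= lerD2l /kp -!mulrA ler_wpM2l ?(ltW e0)//.
    rewrite ler_wpM2l ?(ltW eta0)//.
    have -> : \sum_k ((V *m z) k ord0) ^+ 2 = \sum_k z k ord0 ^+ 2.
      by rewrite -!cV_sqr_sum trmx_mul mulmxA -(mulmxA _ V^T) (mulmx1C VV) mulmx1.
    exact: kapS.
  rewrite (bigD1 k0)//= mxE lk0 mulr0 add0r powRM ?(ltW e0) ?(ltW kp0)//.
  have : (1 - e) * f <= \sum_(k | k != k0) lam' ord0 k `^ p.
    rewrite fE (bigD1 k0)//= lk0 powR0 ?gt_eqF// add0r mulr_sumr.
    apply: ler_sum => k _; apply: (@le_trans _ _ ((1 - e) `^ p * lam ord0 k `^ p)).
      rewrite ler_wpM2r ?powR_ge0//.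
      have E : 1 - e = (1 - e) `^ p * (1 - e) `^ (1 - p).
        by rewrite -powRD ?subrKC ?powRr1 ?(ltW e1')// (gt_eqF e1') implybT.
      rewrite {1}E ler_piMr ?powR_ge0// (le_trans (powR_bernoulli e1' _))//.
        by rewrite subr_ge0 ltW//= gerBl ltW.
      by rewrite gerDl mulr_ge0_le0 ?subr_ge0 ?(ltW p1)//; lra.
    rewrite -powRM ?(ltW e1')// ge0_ler_powR ?nnegrE ?(ltW p0)//.
    - by rewrite mulr_ge0 ?(ltW e1').
    - exact: ltW.
    - by rewrite mxE lerDl mulr_ge0 ?ltW.
  lra.
have kpp : 0 < kp `^ p by exact: powR_gt0.
(* With [e = q^(1/(1-p))] one has [e = e^p q], so [key] would give [kp^p <= q f]; [q] is chosen
   below 1 with [q f < kp^p]. *)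
pose q := Num.min 1 (kp `^ p) / (2 * (1 + f)).
have q0 : 0 < q by rewrite divr_gt0 ?lt_min ?ltr01 ?mulr_gt0 ?ltr_pwDl.
have q1 : q < 1.
  rewrite ltr_pdivrMr ?mulr_gt0 ?ltr_pwDl// mul1r.
  by apply: (@le_lt_trans _ _ 1); [rewrite ge_min lexx|lra].
have p1' : 0 < 1 - p by rewrite subr_gt0.
pose e := q `^ (1 - p)^-1.
have eq : e `^ (1 - p) = q by rewrite /e -powRrM mulVf ?gt_eqF// powRr1 ?ltW.
have e0 : 0 < e by exact: powR_gt0.
have e1 : e < 1.
  have : e < 1 `^ (1 - p)^-1.
    by rewrite gt0_ltr_powR ?invr_gt0 ?nnegrE// ltW.
  by rewrite powR1.
have := key e; rewrite e0 e1 => /(_ isT).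
have {2}-> : e = e `^ p * q.
  rewrite -eq -powRD; first by rewrite addrC subrK powRr1// ltW.
  by rewrite (gt_eqF e0) implybT.
rewrite -mulrA ler_pM2l ?powR_gt0//; apply/negP; rewrite -ltNge.
rewrite /q mulrAC ltr_pdivrMr ?mulr_gt0 ?ltr_pwDl//.
apply: (@le_lt_trans _ _ (kp `^ p * f)).
  by rewrite ler_wpM2r// ge_min lexx orbT.
rewrite ltr_pM2l//; lra.
Qed.

(** After a fraction [d] of [w i] is dropped, (T) bounds the remaining power trace below by
    [f - w_i g (1 - (1-d)^p)], and optimality of [w] against the rescaled design bounds it above by
    [(1-x)^p f]. Comparing first-order terms in [d] and dividing by [p d w_i] leaves an error
    [d c_i f]. *)
Lemma optimal_cost_le_gain (R : realType) (m s : nat) (M : 'I_s -> 'M[R]_m)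
    (c : 'I_s -> R) (B p : R) (w : 'I_s -> R) (V : 'M[R]_m) (lam : 'rV[R]_m) i :
  (0 < m)%N -> (forall i, psdmx (M i)) -> (forall i, 0 <= c i) -> 0 < B ->
  0 < p < 1 -> optimal_design M c B p w -> V *m V^T = 1%:M ->
  info_mx M w = V^T *m diag_mx lam *m V -> (forall k, 0 < lam ord0 k) ->
  0 < w i -> c i * phi M p w <= B * gain V lam p (M i).
Proof.
move=> m0 hM c0 B0 /andP[p0 p1] hw VV WE lam0 wi.
have [[w0 wB] _] := hw.
have f0 : 0 <= phi M p w by exact: tracepow_ge0.
have g0 := gain_ge0 V lam p (hM i).
set f := phi M p w in f0 *; set g := gain V lam p (M i) in g0 *.
apply: (@le_of_small_error _ _ _ (c i * f)); first exact: mulr_ge0.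
move=> d /andP[d0 d1]; have d1' : 0 < 1 - d by rewrite subr_gt0.
have [|] := @feasible_rescaled_drop R s c B w i d c0 B0 (conj w0 wB).
  by rewrite ltW.
set x := _ / B => /andP[x0 x1] /(optimal_tracepow m0 p0 hw).
have x1' : 0 < 1 - x by rewrite subr_gt0.
have hD : psdmx (info_mx M (drop_weight w i d)).
  by apply: info_mx_psd => //; apply: drop_weight_ge0; rewrite // !ltW.
rewrite /phi; have -> : info_mx M (fun j => (1 - x)^-1 * drop_weight w i d j)
    = (1 - x)^-1 *: info_mx M (drop_weight w i d).
  by rewrite /info_mx scaler_sumr; apply: eq_bigr => j _; rewrite scalerA.
rewrite tracepowZ ?gt_eqF ?invr_ge0 ?(ltW x1')// -/(phi M p w) -/f.
rewrite powR_inv_base// ler_pdivrMl ?powR_gt0// => hup.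
have wM j : psdmx (w j *: M j) by exact: psdmxZ.
have := @trace_power_ge R m 'I_s p (fun j => w j *: M j)
  (fun j => if j == i then 1 - d else 1) V _ lam _ VV lam0 wM _ hD _ _.
rewrite p0 (ltW p1) => /(_ isT) hlow.
have {}hlow : f - w i * g + (1 - d) `^ p * (w i * g)
    <= tracepow p (info_mx M (drop_weight w i d)).
  apply: le_trans (hlow _ _ _).
  - have fE : f = \sum_j w j * gain V lam p (M j).
      under eq_bigr => j _ do rewrite -gainZ.
      rewrite -gain_sum -/(info_mx M w) WE gain_spectral//.
      by rewrite /f /phi WE tracepow_spectral// gt_eqF.
    rewrite fE (bigD1 i)//= [leRHS](bigD1 i)//= eqxx gainZ -/g.
    rewrite [w i * g + _]addrC addrK [leLHS]addrC lerD2l le_eqVlt; apply/orP; left.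
    by apply/eqP/eq_bigr => j /negbTE ->; rewrite powR1 mul1r gainZ.
  - by move=> j; case: ifP => // _; exact: ltW.
  - by move=> z; rewrite -qf_sum -/(info_mx M w) WE.
  - move=> z; rewrite qf_info_mx; apply: ler_sum => j _.
    by rewrite /drop_weight qfZ; case: ifP => _; rewrite ?mulrA// mul1r.
have p01 : 0 <= p <= 1 by rewrite !ltW.
have b1 := powR_bernoulli x1' p01.
have {hup hlow} h : f * (p * x) <= w i * g * (1 - (1 - d) `^ p).
  have : (1 - x) `^ p * f <= (1 + p * (1 - x - 1)) * f by rewrite ler_wpM2r.
  lra.
(* Bernoulli bounds [(1 - d)^p] from above, whereas a lower bound is wanted here; it comes from
   Bernoulli at [1 / (1 - d)]. *)
have b2 : (1 - (1 - d) `^ p) * (1 - d) <= p * d.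
  have d2 : 0 < (1 - d)^-1 by rewrite invr_gt0.
  have := powR_bernoulli d2 p01.
  rewrite powR_inv_base//.
  have u0 : 0 < (1 - d) `^ p by exact: powR_gt0.
  have u1 : (1 - d) `^ p <= 1 + p * (1 - d - 1) by exact: powR_bernoulli.
  set u := (1 - d) `^ p in u0 u1 *.
  have -> : 1 + p * ((1 - d)^-1 - 1) = (1 - d + p * d) / (1 - d).
    by field; rewrite gt_eqF.
  rewrite -[u^-1]mul1r ler_pdivrMr// mulrAC ler_pdivlMr// mul1r => hu.
  have pd0 : 0 <= p * d by rewrite mulr_ge0// ltW.
  have : p * d * u <= p * d by rewrite ler_piMr//; lra.
  lra.
have h2 : f * (p * x) * (1 - d) <= w i * g * (p * d).
  apply: le_trans (ler_wpM2r (ltW d1') h) _.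
  by rewrite -[leLHS]mulrA ler_wpM2l ?mulr_ge0 ?(ltW wi).
have h3 : (p * d * w i) * (f * c i * (1 - d)) <= (p * d * w i) * (B * g).
  have -> : p * d * w i * (f * c i * (1 - d)) = B * (f * (p * x) * (1 - d)).
    by rewrite /x; field; rewrite gt_eqF.
  have -> : p * d * w i * (B * g) = B * (w i * g * (p * d)) by ring.
  by rewrite ler_wpM2l// ltW.
move: h3; rewrite ler_pM2l ?mulr_gt0//; lra.
Qed.

(** * Determinant and rank: the case p = 0 *)

Lemma det_spectral (R : realType) (m : nat) (V : 'M[R]_m) (lam : 'rV[R]_m) :
  V *m V^T = 1%:M -> \det (V^T *m diag_mx lam *m V) = \prod_k lam ord0 k.
Proof.
by move=> VV; rewrite !det_mulmx mulrC mulrA -det_mulmx VV det1 mul1r det_diag.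
Qed.

Lemma psdmx_det_ge0 (R : realType) (m : nat) (M : 'M[R]_m) :
  psdmx M -> 0 <= \det M.
Proof.
move=> /psdmx_spectral[[V lam] /= [VV -> lam0]].
by rewrite det_spectral// prodr_ge0.
Qed.

Lemma optimal_det (R : realType) (m s : nat) (M : 'I_s -> 'M[R]_m)
    (c : 'I_s -> R) (B : R) (w : 'I_s -> R) :
  (0 < m)%N -> (forall i, psdmx (M i)) -> optimal_design M c B 0 w ->
  forall v, feasible c B v -> \det (info_mx M v) <= \det (info_mx M w).
Proof.
move=> m0 hM [[w0 _] h] v fv; have := h v fv; rewrite /Phi eqxx.
apply: contraTT; rewrite -!ltNge => dd.
by rewrite gt0_ltr_powR ?invr_gt0 ?ltr0n// nnegrE psdmx_det_ge0//;
  apply: info_mx_psd => //; case: fv.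
Qed.

Lemma col_mulmx (R : realType) (m n q : nat) (A : 'M[R]_(m, n))
    (B : 'M[R]_(n, q)) k : col k (A *m B) = A *m col k B.
Proof. by rewrite !colE mulmxA. Qed.

Lemma qf_scale (R : realType) (m : nat) (G : 'M[R]_m) (a : R) (z : 'cV[R]_m) :
  qf G (a *: z) = a ^+ 2 * qf G z.
Proof.
rewrite /qf [(a *: z)^T]linearZ /= -!scalemxAl -scalemxAr scalerA mxE.
by rewrite expr2.
Qed.

Lemma qf_col (R : realType) (m : nat) (S G : 'M[R]_m) k :
  (S^T *m G *m S) k k = qf G (col k S).
Proof. by rewrite /qf tr_col -row_mul -col_mulmx -row_mul [RHS]mxE [RHS]mxE. Qed.

(* [E] is G in coordinates where W is the identity. *)
Lemma relative_form (R : realType) (m : nat) (V G : 'M[R]_m) (lam : 'rV[R]_m) :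
  V *m V^T = 1%:M -> (forall k, 0 < lam ord0 k) -> psdmx G ->
  (forall z, qf G z <= qf (V^T *m diag_mx lam *m V) z) ->
  exists T E : 'M[R]_m, [/\ T^T *m T = V^T *m diag_mx lam *m V,
    T \in unitmx, G = T^T *m E *m T, psdmx E &
    (forall z : 'cV_m, qf E z <= \sum_k z k ord0 ^+ 2) /\
    \tr E = gain V lam 0 G].
Proof.
move=> VV lam0 hG GW; have V'V := mulmx1C VV.
pose r : 'rV[R]_m := \row_k Num.sqrt (lam ord0 k).
pose q : 'rV[R]_m := \row_k (Num.sqrt (lam ord0 k))^-1.
have sq0 k : Num.sqrt (lam ord0 k) != 0 by rewrite gt_eqF// sqrtr_gt0.
have qr : diag_mx q *m diag_mx r = 1%:M.
  apply/matrixP => i j; rewrite mul_diag_mx !mxE.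
  by case: eqP => [->|_]; rewrite ?mulr1n ?mulr0n ?mulr0// mulVf.
have rr : diag_mx r *m diag_mx r = diag_mx lam.
  apply/matrixP => i j; rewrite mul_diag_mx !mxE.
  case: eqP => [->|_]; rewrite ?mulr1n ?mulr0n ?mulr0//.
  by rewrite -expr2 sqr_sqrtr// ltW.
have [T TE] : exists T, T = diag_mx r *m V by exists (diag_mx r *m V).
have [S SE] : exists S, S = V^T *m diag_mx q by exists (V^T *m diag_mx q).
have ST : S *m T = 1%:M by rewrite SE TE mulmxA -(mulmxA V^T) qr mulmx1.
have TS := mulmx1C ST.
have TT : T^T *m T = V^T *m diag_mx lam *m V.
  by rewrite -rr TE trmx_mul tr_diag_mx !mulmxA.
exists T, (S^T *m G *m S); split=> //.
- by case/mulmx1_unit: TS.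
- rewrite !mulmxA -trmx_mul ST trmx1 mul1mx.
  by rewrite -mulmxA ST mulmx1.
- split; first by apply/symmetricmxP; rewrite !trmx_mul trmxK (psdmx_sym hG) !mulmxA.
  move=> z; have := psdmx_qf_ge0 (S *m z) hG.
  by rewrite /qf trmx_mul !mulmxA.
split.
  move=> z; apply: (@le_trans _ _ (qf G (S *m z))).
    by rewrite /qf trmx_mul !mulmxA.
  apply: (le_trans (GW _)); rewrite -TT -cV_sqr_sum /qf trmx_mul.
  rewrite -!mulmxA (mulmxA T) TS mul1mx (mulmxA S^T) -trmx_mul TS trmx1.
  by rewrite mul1mx.
(* Column [k] of [S] is the [k]-th eigenvector of [W] divided by the square root of its eigenvalue,
   so the [k]-th diagonal entry of [E] carries the weight [lam_k^(0-1)]. *)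
rewrite /mxtrace /gain; apply: eq_bigr => k _.
rewrite qf_col.
have -> : col k S = (Num.sqrt (lam ord0 k))^-1 *: col k V^T.
  by apply/matrixP => i j; rewrite SE mul_mx_diag !mxE mulrC.
by rewrite sub0r powR_inv1 ?qf_scale ?exprVn ?sqr_sqrtr// ltW.
Qed.

(* A projector onto the column space of [E] has trace at most [\rank E]. *)
Lemma trace_le_rank (R : realType) (m : nat) (E : 'M[R]_m) :
  (forall z : 'cV_m, qf E z <= \sum_k z k ord0 ^+ 2) ->
  \tr E <= (\rank E)%:R.
Proof.
move=> E1; pose X := col_base E.
have [F [FT FF FX trF]] :=
  orthogonal_projector [seq col k X | k <- enum 'I_(\rank E)].
have {}FX : F *m X = X.
  apply/matrixP => i k; have /FX/matrixP/(_ i ord0) :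
      col k X \in [seq col k X | k <- enum 'I_(\rank E)].
    by apply: map_f; rewrite mem_enum.
  by rewrite -col_mulmx !mxE.
have FE : F *m E = E by rewrite -{1}[E]mulmx_base mulmxA FX mulmx_base.
have -> : \tr E = \tr (F *m E *m F) by rewrite mxtrace_mulC mulmxA FF FE.
apply: le_trans (_ : \tr F <= _); last by rewrite size_map -cardE card_ord in trF.
rewrite -{3}FF; apply: ler_sum => k _.
have := E1 (col k F); rewrite -cV_sqr_sum /qf tr_col FT -!row_mul -!col_mulmx.
by rewrite !mxE.
Qed.

(** The Weierstrass product inequality. The range of the partial products is carried through the
    induction, since the step uses [(1 - b)(1 - b') >= 0]. *)
Lemma prod_one_sub_ge (R : realType) (I : finType) (x : I -> R) :
  (forall i, 0 <= x i <= 1) -> 1 - \sum_i x i <= \prod_i (1 - x i).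
Proof.
move=> x01.
suff : 1 - \sum_i x i <= \prod_i (1 - x i) /\ 0 <= \prod_i (1 - x i) <= 1.
  by case.
apply: (big_ind2 (fun a b => 1 - a <= b /\ 0 <= b <= 1)).
- by rewrite subr0 ler01 !lexx.
- move=> a b a' b' [h /andP[b0 b1]] [h' /andP[b'0 b'1]]; split.
    have : 0 <= (1 - b) * (1 - b') by rewrite mulr_ge0// subr_ge0.
    lra.
  by rewrite mulr_ge0//= mulr_ile1.
- move=> i _; have /andP[x0 x1] := x01 i; split=> //.
  by rewrite subr_ge0 x1 gerBl.
Qed.

(** The eigenvalues of [E] lie in [[0, 1]], so the determinant is a product to which the Weierstrass
    inequality applies. *)
Lemma det_one_sub_ge (R : realType) (m : nat) (E : 'M[R]_m) (d : R) :
  psdmx E -> (forall z : 'cV_m, qf E z <= \sum_k z k ord0 ^+ 2) ->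
  0 <= d <= 1 -> 1 - d * \tr E <= \det (1%:M - d *: E).
Proof.
move=> /psdmx_spectral[[U e] /= [UU EE e0]] E1 /andP[d0 d1].
have U'U := mulmx1C UU.
have e1 k : e ord0 k <= 1.
  have := E1 (col k U^T); rewrite EE qf_spectral (bigD1 k)//= big1 => [|r rk].
    rewrite mulmx_col_tr// eqxx expr1n mulr1 addr0.
    rewrite -cV_sqr_sum tr_col trmxK -row_mul -col_mulmx UU.
    by rewrite !mxE eqxx.
  by rewrite mulmx_col_tr// (negbTE rk) expr0n mulr0.
have -> : 1%:M - d *: E = U^T *m diag_mx (const_mx 1 - d *: e) *m U.
  have -> : diag_mx (const_mx 1 - d *: e) = 1%:M - d *: diag_mx e.
    by rewrite linearB linearZ /= diag_const_mx.
  by rewrite mulmxBr mulmxBl mulmx1 U'U -scalemxAr -scalemxAl EE.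
rewrite det_spectral// EE mxtrace_mulC mulmxA UU mul1mx mxtrace_diag mulr_sumr.
under [leRHS]eq_bigr => k _ do rewrite !mxE.
apply: prod_one_sub_ge => k; rewrite mulr_ge0//= mulr_ile1//.
Qed.

Lemma psdmx_qf_eq0 (R : realType) (m : nat) (M : 'M[R]_m) z :
  psdmx M -> qf M z = 0 -> M *m z = 0.
Proof.
move=> /psdmx_spectral[[U e] /= [UU -> e0]]; rewrite qf_spectral => /eqP.
rewrite psumr_eq0 => [/allP h|r _]; last by rewrite mulr_ge0// sqr_ge0.
rewrite -!mulmxA [diag_mx _ *m _](_ : _ = 0) ?mulmx0//.
apply/matrixP => r j; rewrite mul_diag_mx [LHS]mxE [RHS]mxE ord1.
have := h r (mem_index_enum _); rewrite /= mulf_eq0 sqrf_eq0.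
by case/orP => /eqP ->; rewrite ?mul0r ?mulr0.
Qed.

Lemma rank_le_of_null (R : realType) (m : nat) (G N : 'M[R]_m) :
  G^T = G -> N^T = N -> (forall z : 'cV_m, N *m z = 0 -> G *m z = 0) ->
  (\rank G <= \rank N)%N.
Proof.
move=> GT NT h; suff : (\rank (kermx N) <= \rank (kermx G))%N.
  by rewrite !mxrank_ker leq_sub2lE// rank_leq_row.
apply/mxrankS/rV_subP => u /sub_kermxP uN; apply/sub_kermxP.
by apply: trmx_inj; rewrite trmx_mul GT trmx0 h// -NT -trmx_mul uN trmx0.
Qed.

(** A uniform design already has positive determinant, and the optimal one is at least as large. *)
Lemma optimal_info_mx_pd0 (R : realType) (m s : nat) (M : 'I_s -> 'M[R]_m)
    (c : 'I_s -> R) (B : R) (w : 'I_s -> R) (V : 'M[R]_m) (lam : 'rV[R]_m) :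
  (0 < m)%N -> (forall i, psdmx (M i)) -> \rank (\sum_i M i)%R = m ->
  (forall i, 0 <= c i) -> 0 < B ->
  optimal_design M c B 0 w -> V *m V^T = 1%:M ->
  info_mx M w = V^T *m diag_mx lam *m V -> (forall k, 0 <= lam ord0 k) ->
  forall k, 0 < lam ord0 k.
Proof.
move=> m0 hM rS c0 B0 hw VV WE lam0 k.
have [eta eta0 feta] := feasible_uniform c0 B0.
have := optimal_det m0 hM hw feta.
rewrite info_mx_const detZ WE det_spectral// => h.
have : 0 < \prod_k lam ord0 k.
  apply: lt_le_trans h; rewrite mulr_gt0 ?exprn_gt0// lt_neqAle eq_sym.
  rewrite psdmx_det_ge0 ?andbT; last exact: psdmx_sum.
  have : (\sum_i M i) \in unitmx by rewrite -row_free_unit -row_leq_rank rS.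
  by rewrite unitmxE unitfE.
move/gt_eqF/negbT/prodf_neq0/(_ k isT) => lk.
by rewrite lt_neqAle eq_sym lk lam0.
Qed.

(** In coordinates where [W] is the identity, dropping a fraction [d] of [w i] multiplies the
    determinant by [det (1 - d E)], at least [1 - d w_i g], while optimality keeps this factor below
    [(1 - x)^m]. First-order terms in [d] give the claim, with [m] in the role of the rank of
    [W]. *)
Lemma optimal_cost_le_gain0 (R : realType) (m s : nat) (M : 'I_s -> 'M[R]_m)
    (c : 'I_s -> R) (B : R) (w : 'I_s -> R) (V : 'M[R]_m) (lam : 'rV[R]_m) i :
  (0 < m)%N -> (forall i, psdmx (M i)) -> (forall i, 0 <= c i) -> 0 < B ->
  optimal_design M c B 0 w -> V *m V^T = 1%:M ->
  info_mx M w = V^T *m diag_mx lam *m V -> (forall k, 0 < lam ord0 k) ->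
  0 < w i -> c i * m%:R <= B * gain V lam 0 (M i).
Proof.
move=> m0 hM c0 B0 hw VV WE lam0 wi.
have [[w0 wB] _] := hw.
have g0 := gain_ge0 V lam 0 (hM i).
have hG : psdmx (w i *: M i) by exact: psdmxZ.
have GW z : qf (w i *: M i) z <= qf (V^T *m diag_mx lam *m V) z.
  rewrite -WE qf_info_mx qfZ (bigD1 i)//= lerDl sumr_ge0// => j _.
  by rewrite mulr_ge0// psdmx_qf_ge0.
have [T [E [TT uT GE hE [E1 trE]]]] := relative_form VV lam0 hG GW.
rewrite gainZ in trE; set g := gain _ _ _ _ in g0 trE *.
apply: (@le_of_small_error _ _ _ (m%:R * (w i * c i * g))).
  by rewrite !mulr_ge0.
move=> d /andP[d0 d1].
have [|] := @feasible_rescaled_drop R s c B w i d c0 B0 (conj w0 wB).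
  by rewrite ltW.
set x := _ / B => /andP[x0 x1] /(optimal_det m0 hM hw).
have x1' : 0 < 1 - x by rewrite subr_gt0.
have -> : info_mx M (fun j => (1 - x)^-1 * drop_weight w i d j)
    = (1 - x)^-1 *: info_mx M (drop_weight w i d).
  by rewrite /info_mx scaler_sumr; apply: eq_bigr => j _; rewrite scalerA.
rewrite detZ info_mx_drop WE -TT -scalerA GE.
have -> : T^T *m T - d *: (T^T *m E *m T) = T^T *m (1%:M - d *: E) *m T.
  by rewrite mulmxBr mulmxBl mulmx1 -scalemxAr -scalemxAl.
have dT : 0 < \det T ^+ 2.
  by rewrite lt_neqAle sqr_ge0 andbT eq_sym sqrf_eq0 -unitfE -unitmxE.
rewrite !det_mulmx !det_tr mulrAC -expr2 mulrCA ger_pMr//.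
rewrite exprVn ler_pdivrMl ?exprn_gt0// mulr1 => hdet.
have := det_one_sub_ge hE E1 (_ : 0 <= d <= 1).
rewrite trE (ltW d0) (ltW d1) => /(_ isT)/le_trans/(_ hdet) {}hdet.
(* Combined with [(1 - x)^m (1 + x)^m <= 1], this replaces [(1 - x)^m] by [1 / (1 + m x)]. *)
have mx : 1 + m%:R * x <= (1 + x) ^+ m.
  elim: (m) => [|k IH]; first by rewrite mul0r addr0 expr0.
  rewrite exprS -addn1 natrD; apply: (@le_trans _ _ ((1 + x) * (1 + k%:R * x))).
    have : 0 <= k%:R * x ^+ 2 by rewrite mulr_ge0 ?ler0n ?sqr_ge0.
    nra.
  by rewrite ler_wpM2l// addr_ge0.
have one : (1 - x) ^+ m * (1 + m%:R * x) <= 1.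
  apply: (@le_trans _ _ ((1 - x) ^+ m * (1 + x) ^+ m)).
    by rewrite ler_wpM2l// exprn_ge0// ltW.
  rewrite -exprMn exprn_ile1//; nra.
have mx0 : 0 <= 1 + m%:R * x by rewrite addr_ge0// mulr_ge0.
have {one hdet} h : (1 - d * (w i * g)) * (1 + m%:R * x) <= 1.
  by apply: le_trans one; rewrite ler_wpM2r.
have h2 : (d * w i) * (c i * m%:R)
    <= (d * w i) * (B * g + d * (m%:R * (w i * c i * g))).
  have xB : x * B = d * w i * c i by rewrite /x divfK ?gt_eqF.
  have -> : d * w i * (c i * m%:R) = B * (m%:R * x).
    have -> : B * (m%:R * x) = m%:R * (x * B) by ring.
    by rewrite xB; ring.
  have -> : d * w i * (B * g + d * (m%:R * (w i * c i * g)))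
      = B * (d * (w i * g) * (1 + m%:R * x)).
    have -> : B * (d * (w i * g) * (1 + m%:R * x))
      = d * w i * g * (B + m%:R * (x * B)) by ring.
    by rewrite xB; ring.
  rewrite ler_wpM2l ?(ltW B0)//; lra.
by move: h2; rewrite ler_pM2l ?mulr_gt0.
Qed.

(** The weights [u] restrict [w] to the support of [n]. Their form lies below [W], so its normalized
    version [E] has trace at most its rank. A vector killed by the matrix of [n] has zero form for
    every [M i] in that support, so the rank for [u] is at most the rank for [n]. *)
Lemma gain0_le_rank (R : realType) (m s : nat) (M : 'I_s -> 'M[R]_m)
    (w n : 'I_s -> R) (V : 'M[R]_m) (lam : 'rV[R]_m) :
  (forall i, psdmx (M i)) -> (forall i, 0 <= w i) -> (forall i, 0 <= n i) ->
  V *m V^T = 1%:M -> (forall k, 0 < lam ord0 k) ->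
  info_mx M w = V^T *m diag_mx lam *m V ->
  \sum_(i | n i != 0) w i * gain V lam 0 (M i) <= (\rank (info_mx M n))%:R.
Proof.
move=> hM w0 n0 VV lam0 WE.
pose u i := if n i != 0 then w i else 0.
have u0 i : 0 <= u i by rewrite /u; case: ifP.
have hG := info_mx_psd hM u0; have hN := info_mx_psd hM n0.
have GW z : qf (info_mx M u) z <= qf (V^T *m diag_mx lam *m V) z.
  rewrite -WE !qf_info_mx; apply: ler_sum => i _; rewrite /u; case: ifP => // _.
  by rewrite mul0r mulr_ge0// psdmx_qf_ge0.
have [T [E [TT uT GE hE [E1 trE]]]] := relative_form VV lam0 hG GW.
have -> : \sum_(i | n i != 0) w i * gain V lam 0 (M i) = \tr E.
  rewrite trE gain_sum big_mkcond; apply: eq_bigr => i _.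
  by rewrite gainZ /u; case: ifP => // _; rewrite mul0r.
apply: (le_trans (trace_le_rank E1)); rewrite ler_nat.
have -> : \rank E = \rank (info_mx M u).
  rewrite GE mxrankMfree ?row_free_unit// -[RHS]mxrank_tr trmx_mul trmxK.
  by rewrite mxrankMfree ?row_free_unit// mxrank_tr.
apply: rank_le_of_null => [||z Nz]; try exact: psdmx_sym.
apply: psdmx_qf_eq0 => //.
have : qf (info_mx M n) z = 0 by rewrite /qf -mulmxA Nz mulmx0 mxE.
rewrite !qf_info_mx => /eqP; rewrite psumr_eq0 => [/allP h|i _]; last first.
  by rewrite mulr_ge0// psdmx_qf_ge0.
apply: big1 => i _; rewrite /u; case: ifPn => [ni|_]; last by rewrite mul0r.
have := h i (mem_index_enum _); rewrite /= mulf_eq0 (negbTE ni) => /eqP ->.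
by rewrite mulr0.
Qed.

(** * From the optimality conditions to the bound *)

(** The closing step shared by the three ranges of [p]: the optimality conditions are averaged with
    weights [a i], [g] being a gain or a trace. *)
Lemma weighted_cost_le (R : realType) (s : nat) (c a g : 'I_s -> R)
    (B f N : R) :
  0 < B -> 0 < f -> (forall i, 0 <= a i) ->
  (forall i, a i != 0 -> c i * f <= B * g i) -> \sum_i a i * g i <= N ->
  B^-1 * \sum_i c i * a i <= N / f.
Proof.
move=> B0 f0 a0 cg gN; rewrite ler_pdivlMr// -mulrA ler_pdivrMl// mulr_suml.
apply: le_trans (ler_wpM2l (ltW B0) gN); rewrite mulr_sumr.
apply: ler_sum => i _; have [->|ai] := eqVneq (a i) 0.
  by rewrite mulr0 !mul0r mulr0.
by rewrite mulrAC [leLHS]mulrC [leRHS]mulrCA ler_wpM2l// cg.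
Qed.

Lemma spow_ge0 (R : realType) (a x : R) : 0 <= spow a x.
Proof. by rewrite /spow; case: ifP => // _; exact: powR_ge0. Qed.

Lemma spow_neq0 (R : realType) (a x : R) : spow a x != 0 -> a != 0.
Proof. by rewrite /spow; case: (a == 0); rewrite ?eqxx. Qed.

(** The criterion is linear here, so the single drop fraction 1/2 gives the exact condition and no
    limit is taken. *)
Lemma optimal_cost_le_trace (R : realType) (m s : nat) (M : 'I_s -> 'M[R]_m)
    (c : 'I_s -> R) (B : R) (w : 'I_s -> R) i :
  (0 < m)%N -> (forall i, psdmx (M i)) -> (forall i, 0 <= c i) -> 0 < B ->
  optimal_design M c B 1 w -> 0 < w i -> c i * phi M 1 w <= B * \tr (M i).
Proof.
move=> m0 hM c0 B0 hw wi; have [[w0 wB] _] := hw.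
have h2 : 0 <= (2^-1 : R) < 1 by apply/andP; split; lra.
have [] := @feasible_rescaled_drop R s c B w i 2^-1 c0 B0 (conj w0 wB) h2.
set x := _ / B => /andP[x0 x1].
have x1' : 0 < 1 - x by rewrite subr_gt0.
move=> /(optimal_tracepow m0 ltr01 hw).
have -> : phi M 1 (fun j => (1 - x)^-1 * drop_weight w i 2^-1 j)
    = (1 - x)^-1 * (phi M 1 w - 2^-1 * w i * \tr (M i)).
  have hW := info_mx_psd hM w0.
  rewrite /phi (_ : info_mx M (fun j => _)
      = (1 - x)^-1 *: info_mx M (drop_weight w i 2^-1)); last first.
    by rewrite /info_mx scaler_sumr; apply: eq_bigr => j _; rewrite scalerA.
  have hD : psdmx (info_mx M (drop_weight w i 2^-1)).
    by apply: info_mx_psd => //; apply: drop_weight_ge0 => //; lra.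
  rewrite tracepowZ ?oner_eq0 ?invr_ge0 ?(ltW x1')// powRr1 ?invr_ge0 ?(ltW x1')//.
  by rewrite !tracepow1// info_mx_drop raddfB /= mxtraceZ.
rewrite ler_pdivrMl// mulrBl mul1r lerD2l lerN2 => h.
have : 2^-1 * w i * (c i * phi M 1 w) <= 2^-1 * w i * (B * \tr (M i)).
  have -> : 2^-1 * w i * (c i * phi M 1 w) = B * (x * phi M 1 w).
    by rewrite /x; field; rewrite gt_eqF.
  by rewrite (mulrCA _ B) ler_wpM2l// ltW.
by rewrite ler_pM2l// mulr_gt0.
Qed.

Theorem proposition3p5 (R : realType) (m s : nat) (M : 'I_s -> 'M[R]_m)
    (c : 'I_s -> R) (B p : R) (wstar : 'I_s -> R)
    (hm : (0 < m)%N)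
    (hM : forall i : 'I_s, psdmx (M i))
    (hrank : \rank (\sum_(k < s) M k)%R = m)
    (hc : forall i : 'I_s, 0 <= c i)
    (hB : 0 < B)
    (hp : 0 <= p <= 1)
    (hwstar : optimal_design M c B p wstar)
    (n : 'I_s -> nat) :
  B^-1 * (\sum_(i < s) c i * spow (n i)%:R p * spow (wstar i) (1 - p))
    <= phi M p (fun i : 'I_s => (n i)%:R) / phi M p wstar.
Proof.
have [[w0 _] _] := hwstar.
have hW := info_mx_psd hM w0.
pose nr i : R := (n i)%:R.
have hN : psdmx (info_mx M nr) by apply: info_mx_psd => // i; exact: ler0n.
have [[V lam] /= [VV WE lam0]] := psdmx_spectral hW.
(* By the convention for [0^0], [a i] vanishes off the support of [wstar], which is where the
   optimality condition may fail. *)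
pose a i := spow (nr i) p * spow (wstar i) (1 - p).
have a0 i : 0 <= a i by rewrite mulr_ge0 ?spow_ge0.
have wpos i : a i != 0 -> 0 < wstar i.
  rewrite mulf_eq0 negb_or => /andP[_ /spow_neq0 wi].
  by rewrite lt_neqAle eq_sym wi w0.
under eq_bigr => i _ do rewrite -mulrA -/(nr i) -/(a i).
have [pE|pn0] := eqVneq p 0.
  rewrite {p hp}pE in hwstar a a0 wpos *.
  have lamp := optimal_info_mx_pd0 hm hM hrank hc hB hwstar VV WE lam0.
  have phiE : phi M 0 wstar = m%:R.
    rewrite /phi /tracepow eqxx; congr _%:R; apply/eqP.
    rewrite -[_ == _]/(_ == m) eqn_leq rank_leq_row row_leq_rank row_free_unit.
    rewrite unitmxE unitfE WE det_spectral//; apply/prodf_neq0 => k _.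
    by rewrite gt_eqF.
  apply: (weighted_cost_le (g := fun i => gain V lam 0 (M i))) => //.
  - by rewrite phiE ltr0n.
  - move=> i /wpos wi; rewrite phiE.
    exact: optimal_cost_le_gain0 hwstar VV WE lamp wi.
  - rewrite /phi [X in _ <= X]/tracepow eqxx.
    have n0 i : 0 <= nr i by exact: ler0n.
    apply: le_trans (gain0_le_rank hM w0 n0 VV lamp WE).
    (* Here [spow (nr i) 0] is the indicator of [nr i != 0] and [spow (wstar i) 1] is [wstar i]. *)
    rewrite [leRHS]big_mkcond; apply: ler_sum => i _.
    rewrite /a /spow; case: ifP => _ /=; first by rewrite !mul0r.
    rewrite powRr0 mul1r subr0; case: ifP => [/eqP ->|_].
      by rewrite !mul0r.
    by rewrite powRr1.
have pgt0 : 0 < p by case/andP: hp => p0 _; rewrite lt_neqAle eq_sym pn0.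
have [pE|pn1] := eqVneq p 1.
  rewrite {p hp pgt0 pn0}pE in hwstar a a0 wpos *.
  have f0 : 0 < phi M 1 wstar.
    have [eta eta0 feta] := feasible_uniform hc hB.
    apply: lt_le_trans (optimal_tracepow hm ltr01 hwstar feta).
    have [kap kap0 kapS] := psdmx_full_rank_lower (psdmx_sum hM) hrank.
    rewrite /phi info_mx_const tracepow1; last first.
      by apply: psdmxZ; [exact: ltW|exact: psdmx_sum].
    rewrite linearZ /= mulr_gt0//.
    (* The basis vectors, put into the coercivity bound, show that each diagonal entry is at least
       [kap]. *)
    apply: (@lt_le_trans _ _ (\sum_(k < m) kap)).
      by rewrite sumr_const card_ord pmulrn_lgt0.
    apply: ler_sum => k _; have := kapS (col k 1%:M).
    rewrite -qf_col trmx1 mul1mx mulmx1 (bigD1 k)//= !mxE eqxx expr1n.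
    apply: le_trans; rewrite ler_peMr ?(ltW kap0)// lerDl sumr_ge0// => j _.
    exact: sqr_ge0.
  apply: (weighted_cost_le (g := fun i => \tr (M i))) => //.
    by move=> i /wpos wi; exact: optimal_cost_le_trace hwstar wi.
  rewrite /phi tracepow1// /info_mx raddf_sum /=; apply: ler_sum => i _.
  have tr0 : 0 <= \tr (M i).
    by apply: sumr_ge0 => k _; have := psdmx_qf_ge0 (col k 1%:M) (hM i);
      rewrite -qf_col trmx1 mul1mx mulmx1.
  (* The factor [spow (wstar i) 0] is 0 or 1, so [a i] is at most [nr i]. *)
  rewrite linearZ /= ler_wpM2r// /a /spow subrr powRr0.
  case: ifP => _; first by rewrite mul0r ler0n.
  by rewrite powRr1 ?ler0n//; case: ifP; rewrite ?mulr1 ?mulr0 ?ler0n.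
have p01 : 0 < p < 1.
  by case/andP: hp => _ p1; rewrite pgt0 lt_neqAle pn1.
have lamp := optimal_info_mx_pd hm hM hrank hc hB p01 hwstar VV WE lam0.
apply: (weighted_cost_le (g := fun i => gain V lam p (M i))) => //.
- rewrite /phi WE tracepow_spectral//.
  rewrite (bigD1 (Ordinal hm))//= ltr_wpDr ?powR_gt0// sumr_ge0// => k _.
  exact: powR_ge0.
- by move=> i /wpos wi; exact: optimal_cost_le_gain p01 hwstar VV WE lamp wi.
(* Off the support of [wstar] the ratio [nr i / wstar i] is [0], which is
   harmless since the matrix [wstar i *: M i] vanishes there too. *)
have := @trace_power_ge R m 'I_s p (fun i => wstar i *: M i)
  (fun i => nr i / wstar i) V _ lam _ VV lamp _ _ hN _ _.
rewrite pgt0 (ltW (proj2 (andP p01))) => /(_ isT) h.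
apply: le_trans (h _ _ _ _).
- apply: ler_sum => i _; rewrite gainZ mulrA ler_wpM2r ?gain_ge0// /a /spow.
  have [->|ni] := eqVneq (nr i) 0; first by rewrite mul0r mulr_ge0 ?powR_ge0.
  have [->|wi] := eqVneq (wstar i) 0; first by rewrite !mulr0.
  have wi0 : 0 < wstar i by rewrite lt_neqAle eq_sym wi w0.
  rewrite powRM ?ler0n ?invr_ge0// powR_inv_base// -mulrA ler_wpM2l ?powR_ge0//.
  by rewrite powRB ?wi ?implybT// powRr1// mulrC.
- by move=> i; exact: psdmxZ.
- by move=> i; rewrite divr_ge0 ?ler0n.
- by move=> z; rewrite -qf_sum -/(info_mx M wstar) WE.
- move=> z; rewrite qf_info_mx; apply: ler_sum => i _; rewrite qfZ mulrA.
  have [wi|wi] := eqVneq (wstar i) 0; last by rewrite divfK.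
  by rewrite wi mulr0 mul0r mulr_ge0 ?ler0n ?psdmx_qf_ge0.
Qed.
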